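(* There is a polynomial time algorithm which, given an undirected graph $G$ on $n$ vertices with positive edge weights and an integer $k$ with $1\le k\le n$, returns an induced subgraph $H$ of $G$ with at least $k$ vertices and density $d(H)\ge \mathrm{dal}(G,k)/2$. That is, there is a polynomial time $2$-approximation algorithm for the densest at-least-$k$-subgraph problem.
   Context: For an induced subgraph $H$ of $G$, $W(H)$ is the sum of the weights of the edges of $H$, $|H|$ is its number of vertices, and its density is $d(H)=W(H)/|H|$. $\mathrm{dal}(G,k)$ denotes the maximum density of an induced subgraph of $G$ with at least $k$ vertices. *)

(* Defs.v *)
(* "Polynomial time" refers to the random access machine with the logarithmic
   cost criterion (Cook-Reckhow; Aho-Hopcroft-Ullman), here with structured
   control flow.  It is polynomially equivalent to the Turing machine.  Since
   inputs must be finite bit strings, edge weights are positive rationals. *)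
From HB Require Import structures.
From mathcomp Require Import all_boot all_order all_algebra.
Set Implicit Arguments.
Unset Strict Implicit.
Unset Printing Implicit Defensive.
Import Order.TTheory GRing.Theory Num.Theory.

Section Machine.
Local Open Scope nat_scope.

Definition memory := nat -> nat.

Definition upd (m : memory) (a v : nat) : memory :=
  fun b => if b == a then v else m b.

(* [EGet e] is the contents of the cell whose address is the value of [e]
   (indirect addressing); [ESub] is truncated, and [EDiv] by 0 yields 0. *)
Inductive expr : Type :=
| ECst of nat
| EGet of expr
| EAdd of expr & expr
| ESub of expr & expr
| EMul of expr & expr
| EDiv of expr & expr.

(* [Store a e] stores the value of [e] in the cell whose address is the value
   of [a]; a test succeeds when its value is nonzero. *)
Inductive cmd : Type :=
| Skip
| Store of expr & expr
| Seq of cmd & cmd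
| If of expr & cmd & cmd
| While of expr & cmd.

Fixpoint eval (m : memory) (e : expr) : nat :=
  match e with
  | ECst c => c
  | EGet a => m (eval m a)
  | EAdd e1 e2 => eval m e1 + eval m e2
  | ESub e1 e2 => eval m e1 - eval m e2
  | EMul e1 e2 => eval m e1 * eval m e2
  | EDiv e1 e2 => eval m e1 %/ eval m e2
  end.

(* Length of the binary expansion of n, with [bits 0 = 1]. *)
Definition bits (n : nat) : nat := (trunc_log 2 n).+1.

(* Logarithmic cost: every subexpression is charged the bit length of its
   value, so each operation pays for its operands and its result, and each
   memory access pays for both the address and the contents. *)
Fixpoint ecost (m : memory) (e : expr) : nat :=
  bits (eval m e) +
  match e with
  | ECst _ => 0
  | EGet a => ecost m a
  | EAdd e1 e2 | ESub e1 e2 | EMul e1 e2 | EDiv e1 e2 => ecost m e1 + ecost m e2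
  end.

(* [exec c m t m'] : run from memory m, c halts after time t in memory m'. *)
Inductive exec : cmd -> memory -> nat -> memory -> Prop :=
| exec_skip m : exec Skip m 1 m
| exec_store a e m :
    exec (Store a e) m (ecost m a + ecost m e) (upd m (eval m a) (eval m e))
| exec_seq c1 c2 m t1 m1 t2 m2 :
    exec c1 m t1 m1 -> exec c2 m1 t2 m2 -> exec (Seq c1 c2) m (t1 + t2) m2
| exec_if e c1 c2 m t m' :
    exec (if eval m e != 0 then c1 else c2) m t m' ->
    exec (If e c1 c2) m (ecost m e + t) m'
| exec_while_false e c m :
    eval m e = 0 -> exec (While e c) m (ecost m e) m
| exec_while_true e c m t1 m1 t2 m2 :
    eval m e != 0 -> exec c m t1 m1 -> exec (While e c) m1 t2 m2 ->
    exec (While e c) m (ecost m e + t1 + t2) m2.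

Lemma exec_det c m t m' :
  exec c m t m' -> forall t0 m0, exec c m t0 m0 -> t0 = t /\ m0 = m'.
Proof.
elim=> {c m t m'}.
- by move=> m t0 m0 H; inversion H.
- by move=> a e m t0 m0 H; inversion H.
- move=> c1 c2 m t1 m1 t2 m2 _ IH1 _ IH2 t0 m0 H.
  inversion H as [| |? ? ? ? ? ? ? E1 E2| | |]; subst.
  by case: (IH1 _ _ E1) => ? ?; subst; case: (IH2 _ _ E2) => ? ?; subst.
- move=> e c1 c2 m t m' _ IH t0 m0 H.
  inversion H as [| | |? ? ? ? ? ? E1| |]; subst.
  by case: (IH _ _ E1) => ? ?; subst.
- move=> e c m e0 t0 m0 H.
  inversion H as [| | | | |? ? ? ? ? ? ? en0 E1 E2]; subst=> //.
  by rewrite e0 eqxx in en0.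
- move=> e c m t1 m1 t2 m2 en0 _ IH1 _ IH2 t0 m0 H.
  inversion H as [| | | |? ? ? e0|? ? ? ? ? ? ? en0' E1 E2]; subst.
    by rewrite e0 eqxx in en0.
  by case: (IH1 _ _ E1) => ? ?; subst; case: (IH2 _ _ E2) => ? ?; subst.
Qed.

(* An input word is a finite sequence of naturals stored from address 0 on,
   all other cells being 0; its length is its total number of bits. *)
Definition init_mem (s : seq nat) : memory := nth 0 s.

Definition input_size (s : seq nat) : nat := \sum_(x <- s) bits x.

End Machine.

Section Graph.
Local Open Scope ring_scope.

(* Values of [wt] outside [edge] are irrelevant. *)
Record wgraph (n : nat) := WGraph {
  edge : rel 'I_n;
  wt : 'I_n -> 'I_n -> rat;
  edge_sym : symmetric edge;
  edge_irr : irreflexive edge;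
  wt_sym : forall i j, wt i j = wt j i;
  wt_pos : forall i j, edge i j -> 0 < wt i j
}.

Variables (n : nat) (G : wgraph n).

(* An induced subgraph is given by its vertex set H; requiring i < j counts
   each edge once. *)
Definition weight (H : {set 'I_n}) : rat :=
  \sum_(i in H) \sum_(j in H | (i < j)%N && edge G i j) wt G i j.

Definition density (H : {set 'I_n}) : rat := weight H / #|H|%:R.

(* Densities are nonnegative, so the default value 0 is harmless as soon as
   some H qualifies, i.e. k <= n. *)
Definition dal (k : nat) : rat :=
  \big[Num.max/0]_(H : {set 'I_n} | (k <= #|H|)%N) density H.

(* Numerator and denominator in lowest terms, for q >= 0; 0 is (0, 1). *)
Definition encode_rat (q : rat) : seq nat := [:: `|numq q|%N; `|denq q|%N].

(* n, k, then the weighted adjacency matrix row by row, with 0 for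
   non-edges. *)
Definition encode (k : nat) : seq nat :=
  [:: n, k & flatten [seq encode_rat (if edge G i j then wt G i j else 0)
                     | i <- enum 'I_n, j <- enum 'I_n]].

(* The cells 0, ..., n-1 contain the characteristic vector of H. *)
Definition outputs (m : memory) (H : {set 'I_n}) : Prop :=
  forall i : 'I_n, m i = (i \in H) :> nat.

End Graph.

(* Main.v *)
(* Clear denominators, so that the weights are natural numbers, and let f(S) be
   the weight of the subgraph induced by S.  If H is optimal, d = d(H) and
   l <= d/2, then f(H) - l|H| >= l|H| >= l k, whereas a set S failing
   f(S) >= l max(k, |S|) has f(S) - l|S| < l (k - |S|)^+.  A set S that succeeds
   has density at least l once padded to k vertices, so it suffices to maximize
   the supermodular function f(S) - l|S| up to an error smaller than l.  This is
   done by projected subgradient ascent on its Lovasz extension over the cube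
   [0, M]^n: each edge gives its weight to the endpoint with the smaller
   coordinate, and the extension is the average of the function over the level
   sets.  At any time l is the best ratio B/D = f(S)/max(k, |S|) among all level
   sets met so far.  While B/D < d/2, every step decreases the squared distance
   to M times the indicator of H by a 1/(4 n^6) fraction of its maximal value, so
   4 n^6 + 1 steps suffice; they only handle integers of polynomial length. *)
Require Import Defs.
From HB Require Import structures.
From mathcomp Require Import all_boot all_order all_algebra.
From Stdlib Require Import FunctionalExtensionality.
From mathcomp Require Import zify ring.
Set Implicit Arguments.
Unset Strict Implicit.
Unset Printing Implicit Defensive.
Import Order.TTheory GRing.Theory Num.Theory.

(** * Running time *)

Lemma bits_leE L x : 0 < L -> (bits x <= L) = (x < 2 ^ L).
Proof.
move=> L0; rewrite /bits; case: (posnP x) => [->|x0].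
  by rewrite trunc_log0 L0 expn_gt0.
apply/idP/idP => [h|h].
  by apply: leq_trans (trunc_log_ltn x (isT : 1 < 2)) _; rewrite leq_exp2l.
by rewrite -(@ltn_exp2l 2) //; apply: leq_ltn_trans (trunc_logP (isT : 1 < 2) x0) h.
Qed.

Lemma ltn_exp2_bits x : x < 2 ^ bits x.
Proof. by rewrite -bits_leE. Qed.

(** When all cells are below [2 ^ L], the value of [e] has at most [L * esize e] bits; the extra
    unit at a binary node pays for carries. *)
Fixpoint esize (e : expr) : nat :=
  match e with
  | ECst c => bits c
  | EGet a => (esize a).+1
  | EAdd e1 e2 | ESub e1 e2 | EMul e1 e2 | EDiv e1 e2 => (esize e1 + esize e2).+1
  end.

Fixpoint eweight (e : expr) : nat :=
  esize e +
  match e with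
  | ECst _ => 0
  | EGet a => eweight a
  | EAdd e1 e2 | ESub e1 e2 | EMul e1 e2 | EDiv e1 e2 => eweight e1 + eweight e2
  end.

(* [L * cweight Z c] bounds the running time of [c] when all cells stay below
   [2 ^ L] and every loop makes fewer than [Z] iterations. *)
Fixpoint cweight (Z : nat) (c : cmd) : nat :=
  match c with
  | Skip => 1
  | Store a e => eweight a + eweight e
  | Seq c1 c2 => cweight Z c1 + cweight Z c2
  | If e c1 c2 => eweight e + (cweight Z c1 + cweight Z c2)
  | While e c => Z * (eweight e + cweight Z c)
  end.

(** The iteration bound is itself polynomial in the input size, so each level of loop nesting
    multiplies the cost by a polynomial. *)
Lemma cweight_poly (z : {poly nat}) c :
  exists p : {poly nat}, forall n, (p.[n])%R = cweight (z.[n])%R c.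
Proof.
elim: c => [|a e|c1 [p1 h1] c2 [p2 h2]|e c1 [p1 h1] c2 [p2 h2]|e c [p h]] /=.
- by exists (1%:P)%R => n; rewrite hornerC.
- by exists ((eweight a + eweight e)%:P)%R => n; rewrite hornerC.
- by exists (p1 + p2)%R => n; rewrite hornerD h1 h2.
- by exists ((eweight e)%:P + (p1 + p2))%R => n; rewrite !hornerD hornerC h1 h2.
- by exists (z * ((eweight e)%:P + p))%R => n; rewrite hornerM hornerD hornerC h.
Qed.

Lemma eval_lt L m e : 0 < L -> (forall x, m x < 2 ^ L) ->
  eval m e < 2 ^ (L * esize e).
Proof.
move=> L0 mL.
(* Sum, truncated difference, product and quotient are all at most [(x + 1) * (y + 1)], so one
   estimate serves the four operations; the factor [2 ^ L >= 2] gives strictness. *)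
have key e1 e2 v : v <= (eval m e1).+1 * (eval m e2).+1 ->
    eval m e1 < 2 ^ (L * esize e1) -> eval m e2 < 2 ^ (L * esize e2) ->
    v < 2 ^ (L * (esize e1 + esize e2).+1).
  move=> h h1 h2; rewrite mulnS !mulnDr expnD.
  apply: leq_trans (_ : 2 * (2 ^ (L * esize e1) * 2 ^ (L * esize e2)) <= _); last first.
    by rewrite expnD leq_mul // -{1}(expn1 2) leq_exp2l.
  have := leq_mul h1 h2; have := ltn0Sn v; nia.
elim: e => [c|a IH|e1 IH1 e2 IH2|e1 IH1 e2 IH2|e1 IH1 e2 IH2|e1 IH1 e2 IH2] /=.
- apply: leq_trans (ltn_exp2_bits c) _; rewrite leq_exp2l //; nia.
- by apply: leq_trans (mL _) _; rewrite leq_exp2l // leq_pmulr.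
- apply: key IH1 IH2; nia.
- apply: key IH1 IH2; nia.
- apply: key IH1 IH2; nia.
- by apply: key IH1 IH2; apply: leq_trans (leq_div _ _) _; nia.
Qed.

Lemma ecost_le L m e : 0 < L -> (forall x, m x < 2 ^ L) ->
  ecost m e <= L * eweight e.
Proof.
move=> L0 mL.
have es0 e' : 0 < esize e' by case: e'.
have bnd e' : bits (eval m e') <= L * esize e'.
  by rewrite bits_leE ?muln_gt0 ?L0 ?es0 // eval_lt.
have step e' r r' : r <= L * r' -> bits (eval m e') + r <= L * (esize e' + r').
  by move=> h; rewrite mulnDr leq_add.
elim: e => [c|a IH|e1 IH1 e2 IH2|e1 IH1 e2 IH2|e1 IH1 e2 IH2|e1 IH1 e2 IH2].
- exact: (step (ECst c) 0 0).
- exact: (step (EGet a)).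
- by apply: (step (EAdd e1 e2)); rewrite mulnDr leq_add.
- by apply: (step (ESub e1 e2)); rewrite mulnDr leq_add.
- by apply: (step (EMul e1 e2)); rewrite mulnDr leq_add.
- by apply: (step (EDiv e1 e2)); rewrite mulnDr leq_add.
Qed.

(** * Programs over named variables *)

(* Scalars use only entry 0: VN = n, VK = k, VP the product of the denominators,
   VW the total weight, VM the side of the cube, VT the number of steps, VB / VD
   the best ratio, VI, VU, VJ counters, VC, VV, VE the size, the weight and
   max(k, size) of the current level set.  Arrays: AW the integer weight matrix,
   AX the current point, AY the best set, AG the loads. *)
Inductive var : Type :=
| VN | VK | VP | VW | VM | VT | VB | VD | VI | VU | VJ | VC | VV | VE
| AW | AX | AY | AG.

Scheme Boolean Equality for var.

Lemma var_beqP : Equality.axiom var_beq.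
Proof. by move=> x y; apply: (iffP idP) => [|->]; [case: x; case: y | case: y]. Qed.

HB.instance Definition _ := hasDecEq.Build var var_beqP.

Definition vars : seq var :=
  [:: VN; VK; VP; VW; VM; VT; VB; VD; VI; VU; VJ; VC; VV; VE; AW; AX; AY; AG].

Definition code (v : var) : nat := index v vars.

Lemma code_lt v : code v < 18.
Proof. by case: v. Qed.

Lemma codeK v : nth VN vars (code v) = v.
Proof. by case: v. Qed.

Definition state := var -> nat -> nat.

Definition supd (s : state) v i x : state :=
  fun v' i' => if (v' == v) && (i' == i) then x else s v' i'.

(* Cell 0 holds the address [b] of the block of variables, entry [i] of the
   variable [v] is at [b + (18 * i + code v)], and [inp] describes the cells
   between 0 and [b]. *)
Definition mem_of (b : nat) (inp : memory) (s : state) : memory :=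
  fun x => if x == 0 then b else if x < b then inp x
           else s (nth VN vars ((x - b) %% 18)) ((x - b) %/ 18).

Lemma mem_ofE b inp s v i : 0 < b -> mem_of b inp s (b + (18 * i + code v)) = s v i.
Proof.
move=> b0; rewrite /mem_of addn_eq0 -[b == 0]negbK -lt0n b0 /=.
rewrite ltnNge leq_addr /= addKn mulnC.
by rewrite modnMDl divnMDl // modn_small ?divn_small ?code_lt // codeK addn0.
Qed.

(* [HR e] is the raw memory cell with address [e]. *)
Inductive hexpr : Type :=
| HC of nat
| HV of var & hexpr
| HR of hexpr
| HAdd of hexpr & hexpr
| HSub of hexpr & hexpr
| HMul of hexpr & hexpr
| HDiv of hexpr & hexpr.

Definition hvar v := HV v (HC 0).

Definition address (v : var) (e : expr) : expr :=
  EAdd (EGet (ECst 0)) (EAdd (EMul (ECst 18) e) (ECst (code v))).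

Fixpoint comp (e : hexpr) : expr :=
  match e with
  | HC c => ECst c
  | HV v e => EGet (address v (comp e))
  | HR e => EGet (comp e)
  | HAdd e1 e2 => EAdd (comp e1) (comp e2)
  | HSub e1 e2 => ESub (comp e1) (comp e2)
  | HMul e1 e2 => EMul (comp e1) (comp e2)
  | HDiv e1 e2 => EDiv (comp e1) (comp e2)
  end.

Definition assign v i e := Store (address v (comp i)) (comp e).

(** The test is a truncated difference, nonzero exactly while the counter is below the bound. *)
Definition for_loop j bnd body :=
  Seq (assign j (HC 0) (HC 0))
      (While (comp (HSub bnd (hvar j)))
             (Seq body (assign j (HC 0) (HAdd (hvar j) (HC 1))))).

Definition fold_loop acc j bnd e0 e :=
  Seq (assign acc (HC 0) e0) (for_loop j bnd (assign acc (HC 0) e)).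

Definition map_loop v j bnd e := for_loop j bnd (assign v (hvar j) e).

(** * Total correctness with a time bound *)

Section Hoare.
Variables (b : nat) (inp : memory) (L Z : nat).

Fixpoint heval (s : state) (e : hexpr) : nat :=
  match e with
  | HC c => c
  | HV v e => s v (heval s e)
  | HR e => mem_of b inp s (heval s e)
  | HAdd e1 e2 => heval s e1 + heval s e2
  | HSub e1 e2 => heval s e1 - heval s e2
  | HMul e1 e2 => heval s e1 * heval s e2
  | HDiv e1 e2 => heval s e1 %/ heval s e2
  end.

Definition bounded (s : state) := forall v i, s v i < 2 ^ L.

(** Boundedness is both assumed and preserved, so each operation can be charged in terms of [L]. The
    input block [inp] is the same before and after: such programs write to variables only. *)
Definition ht (c : cmd) (s : state) (Q : state -> Prop) : Prop :=
  bounded s -> exists t s',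
    [/\ exec c (mem_of b inp s) t (mem_of b inp s'),
        t <= L * cweight Z c, bounded s' & Q s'].

Definition frame (l : seq var) (s s' : state) := forall v, v \notin l -> s' v = s v.

Hypotheses (b_gt0 : 0 < b) (L_gt0 : 0 < L).
Hypotheses (b_lt : b < 2 ^ L) (inp_lt : forall x, inp x < 2 ^ L).

Lemma mem_of_lt s : bounded s -> forall x, mem_of b inp s x < 2 ^ L.
Proof. by move=> sL x; rewrite /mem_of; case: ifP => // _; case: ifP. Qed.

Lemma eval_comp s e : eval (mem_of b inp s) (comp e) = heval s e.
Proof. by elim: e => //= [v e ->|e ->|? -> ? ->|? -> ? ->|? -> ? ->|? -> ? ->] //; rewrite mem_ofE. Qed.

Lemma upd_mem_of s v i x :
  upd (mem_of b inp s) (b + (18 * i + code v)) x = mem_of b inp (supd s v i x).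
Proof.
apply: functional_extensionality => y; rewrite /upd /supd.
case: eqP => [->|ne].
  by rewrite mem_ofE // !eqxx.
rewrite /mem_of; case: ifP => // _; case: ltnP => // ley.
case: andP => // -[/eqP ev /eqP ei]; case: ne.
by rewrite -ei -ev /code index_uniq ?ltn_pmod // mulnC -divn_eq subnKC.
Qed.

Lemma ht_conseq c s (Q Q' : state -> Prop) :
  (forall s', Q s' -> Q' s') -> ht c s Q -> ht c s Q'.
Proof. by move=> QQ' h /h[t [s' [? ? ? /QQ' ?]]]; exists t, s'. Qed.

Lemma ht_skip s (Q : state -> Prop) : Q s -> ht Skip s Q.
Proof. by move=> Qs sL; exists 1, s; split=> //; [exact: exec_skip | rewrite muln1]. Qed.

Lemma ht_assign v i e s (Q : state -> Prop) :
  heval s e < 2 ^ L -> Q (supd s v (heval s i) (heval s e)) -> ht (assign v i e) s Q.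
Proof.
move=> eL Qs sL; have mL := mem_of_lt sL.
exists (ecost (mem_of b inp s) (address v (comp i)) + ecost (mem_of b inp s) (comp e)).
exists (supd s v (heval s i) (heval s e)); split=> //.
- rewrite -upd_mem_of -(eval_comp s e) -(eval_comp s i).
  exact: (exec_store (address v (comp i))).
- have -> : cweight Z (assign v i e) = eweight (address v (comp i)) + eweight (comp e) by [].
  by rewrite mulnDr leq_add // ecost_le.
- by move=> v' i'; rewrite /supd; case: ifP.
Qed.

Lemma ht_set x v e s (Q : state -> Prop) :
  heval s e = x -> x < 2 ^ L -> Q (supd s v 0 x) -> ht (assign v (HC 0) e) s Q.
Proof. by move=> ex xL Qs; apply: ht_assign; rewrite ex. Qed.

Lemma ht_seq c1 c2 s Q : ht c1 s (fun s1 => ht c2 s1 Q) -> ht (Seq c1 c2) s Q.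
Proof.
move=> h /h[t1 [s1 [e1 l1 b1 /(_ b1)[t2 [s2 [e2 l2 b2 Q2]]]]]].
exists (t1 + t2), s2; split=> //; first exact: exec_seq e1 e2.
by rewrite /= mulnDr leq_add.
Qed.

Lemma ht_if e c1 c2 s Q :
  (heval s e != 0 -> ht c1 s Q) -> (heval s e = 0 -> ht c2 s Q) ->
  ht (If (comp e) c1 c2) s Q.
Proof.
move=> h1 h2 sL; have ce := ecost_le (comp e) L_gt0 (mem_of_lt sL).
have [e0|en0] := eqVneq (heval s e) 0.
  have [t [s' [ex le b' Q']]] := h2 e0 sL.
  exists (ecost (mem_of b inp s) (comp e) + t), s'; split=> //.
    by apply: exec_if; rewrite eval_comp e0.
  by rewrite /= !mulnDr; apply: leq_add => //; apply: leq_trans le (leq_addl _ _).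
have [t [s' [ex le b' Q']]] := h1 en0 sL.
exists (ecost (mem_of b inp s) (comp e) + t), s'; split=> //.
  by apply: exec_if; rewrite eval_comp en0.
by rewrite /= !mulnDr; apply: leq_add => //; apply: leq_trans le (leq_addr _ _).
Qed.

(** The value of the test is the number of rounds left, which serves as variant. The test is
    evaluated [N + 1] times, whence [N < Z]. *)
Lemma ht_while (Inv : nat -> state -> Prop) N e c s (Q : state -> Prop) :
  N < Z -> Inv 0 s ->
  (forall i s, i <= N -> Inv i s -> heval s e = N - i) ->
  (forall i s, i < N -> Inv i s -> ht c s (Inv i.+1)) ->
  (forall s, Inv N s -> Q s) -> ht (While (comp e) c) s Q.
Proof.
move=> NZ I0 IE IS IQ sL.
suff gen r i s1 : bounded s1 -> Inv i s1 -> i <= N -> N - i = r -> exists t s',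
    [/\ exec (While (comp e) c) (mem_of b inp s1) t (mem_of b inp s'),
        t <= L * (r.+1 * (eweight (comp e) + cweight Z c)), bounded s' & Q s'].
  have [t [s' [ex le b' Q']]] := gen N 0 s sL I0 isT (subn0 N).
  exists t, s'; split=> //; apply: leq_trans le _.
  by rewrite leq_mul2l /= leq_mul2r NZ !orbT.
elim: r i s1 {s sL I0} => [|r IH] i s sL Ii iN Er.
  have ei : i = N by lia.
  exists (ecost (mem_of b inp s) (comp e)), s; split=> //; last by apply: IQ; rewrite -ei.
    by apply: exec_while_false; rewrite eval_comp (IE i).
  apply: leq_trans (ecost_le _ L_gt0 (mem_of_lt sL)) _.
  by rewrite leq_mul2l mul1n leq_addr orbT.
have iN' : i < N by lia.
have Er' : N - i.+1 = r by lia.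
have [t1 [s1 [e1 l1 b1 I1]]] := IS i s iN' Ii sL.
have [t2 [s2 [e2 l2 b2 Q2]]] := IH i.+1 s1 b1 I1 iN' Er'.
exists (ecost (mem_of b inp s) (comp e) + t1 + t2), s2; split=> //.
  by apply: exec_while_true e1 e2; rewrite eval_comp (IE i) // Er.
have := ecost_le (comp e) L_gt0 (mem_of_lt sL); move: l1 l2.
nia.
Qed.

Lemma ht_for (Inv : nat -> state -> Prop) N j bnd body s (Q : state -> Prop) :
  N < Z -> N < 2 ^ L ->
  Inv 0 (supd s j 0 0) ->
  (forall i s, i <= N -> Inv i s -> s j 0 = i /\ heval s bnd = N) ->
  (forall i s, i < N -> Inv i s ->
     ht body s (fun s' => s' j 0 = i /\ Inv i.+1 (supd s' j 0 i.+1))) ->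
  (forall s, Inv N s -> Q s) ->
  ht (for_loop j bnd body) s Q.
Proof.
move=> NZ NL I0 IE IS IQ; apply: ht_seq; apply: ht_assign; first by rewrite expn_gt0.
apply: (@ht_while Inv N) => // [i s' iN /IE[]// /= -> ->//|i s' iN Ii].
apply: ht_seq; apply: ht_conseq (IS _ _ iN Ii) => s1 [e1 I1].
by apply: ht_assign; rewrite /= e1 addn1 //; apply: leq_ltn_trans NL.
Qed.

Lemma frame_trans l s1 s2 s3 : frame l s1 s2 -> frame l s2 s3 -> frame l s1 s3.
Proof. by move=> h1 h2 v vl; rewrite h2 ?h1. Qed.

Lemma frame_sub l l' s s' : {subset l <= l'} -> frame l s s' -> frame l' s s'.
Proof. by move=> ll' h v vl'; apply: h; apply: contra vl' => /ll'. Qed.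

Lemma frame_supd l s v i x : v \in l -> frame l s (supd s v i x).
Proof.
move=> vl v' v'l; apply: functional_extensionality => i'; rewrite /supd.
by case: eqP => // e; rewrite e vl in v'l.
Qed.

Lemma supd_eq s v i x : supd s v i x v i = x.
Proof. by rewrite /supd !eqxx. Qed.

Lemma supd_neqv s v i x v' i' : v' != v -> supd s v i x v' i' = s v' i'.
Proof. by rewrite /supd => /negPf ->. Qed.

Lemma supd_neqi s v i x v' i' : i' != i -> supd s v i x v' i' = s v' i'.
Proof. by rewrite /supd andbC => /negPf ->. Qed.

Lemma ht_fold (g : nat -> nat) N acc j bnd e0 e s :
  acc != j -> N < Z -> N < 2 ^ L ->
  (forall i, i <= N -> g i < 2 ^ L) ->
  heval s e0 = g 0 ->
  (forall s', frame [:: acc; j] s s' -> heval s' bnd = N) ->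
  (forall s' i, i < N -> frame [:: acc; j] s s' -> s' j 0 = i -> s' acc 0 = g i ->
     heval s' e = g i.+1) ->
  ht (fold_loop acc j bnd e0 e) s
     (fun s' => frame [:: acc; j] s s' /\ s' acc 0 = g N).
Proof.
move=> nej NZ NL gL h0 hb he; apply: ht_seq; apply: ht_assign; first by rewrite h0 gL.
have F0 : frame [:: acc; j] s (supd s acc 0 (g 0)) by apply: frame_supd; rewrite inE eqxx.
have jin : j \in [:: acc; j] by rewrite !inE eqxx orbT.
have accin : acc \in [:: acc; j] by rewrite !inE eqxx.
apply: (@ht_for (fun i s' => [/\ frame [:: acc; j] s s', s' j 0 = i & s' acc 0 = g i]) N) => //=.
- split; rewrite ?supd_eq // ?h0.
    by apply: frame_trans F0 _; apply: frame_supd.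
  by rewrite supd_neqv // supd_eq.
- by move=> i s' iN [/hb].
- move=> i s' iN [F' ej ea]; apply: ht_assign; first by rewrite (he _ i) ?gL.
  rewrite (he _ i) //=; split; first by rewrite supd_neqv // eq_sym.
  split; rewrite ?supd_eq //; last by rewrite supd_neqv // supd_eq.
  by apply: frame_trans F' _; apply: frame_trans (frame_supd _ _ _ accin) (frame_supd _ _ _ jin).
- by move=> s' [].
Qed.

Lemma ht_sum (F : nat -> nat) N acc j bnd e s :
  acc != j -> N < Z -> N < 2 ^ L ->
  \sum_(i < N) F i < 2 ^ L ->
  (forall s', frame [:: acc; j] s s' -> heval s' bnd = N) ->
  (forall s' i, i < N -> frame [:: acc; j] s s' -> s' j 0 = i -> heval s' e = F i) ->
  ht (fold_loop acc j bnd (HC 0) (HAdd (hvar acc) e)) s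
     (fun s' => frame [:: acc; j] s s' /\ s' acc 0 = \sum_(i < N) F i).
Proof.
move=> nej NZ NL sL hb he.
apply: (@ht_fold (fun r => \sum_(i < r) F i)) => //=.
- move=> i iN; apply: leq_ltn_trans sL.
  rewrite -!(big_mkord xpredT F) /= (big_cat_nat (n := i) (p := N)) //=.
  exact: leq_addr.
- by rewrite big_ord0.
- by move=> s' i iN F' ej ea; rewrite (he _ i) // ea big_ord_recr.
Qed.

(** The invariant separates final entries from untouched ones; hence [e] may read the old value of
    the entry it replaces, as [move_point] does. *)
Lemma ht_map (F : nat -> nat) N v j bnd e s :
  v != j -> N < Z -> N < 2 ^ L ->
  (forall i, i < N -> F i < 2 ^ L) ->
  (forall s', frame [:: v; j] s s' -> heval s' bnd = N) ->
  (forall s' i, i < N -> frame [:: v; j] s s' -> s' j 0 = i -> s' v i = s v i ->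
     heval s' e = F i) ->
  ht (map_loop v j bnd e) s
     (fun s' => frame [:: v; j] s s' /\ forall i, i < N -> s' v i = F i).
Proof.
move=> nej NZ NL FL hb he.
have jin : j \in [:: v; j] by rewrite !inE eqxx orbT.
have vin : v \in [:: v; j] by rewrite !inE eqxx.
apply: (@ht_for (fun i s' => [/\ frame [:: v; j] s s', s' j 0 = i,
   forall i', i' < i -> s' v i' = F i' & forall i', i <= i' -> s' v i' = s v i']) N) => //=.
- split; rewrite ?supd_eq //; first exact: frame_supd.
  by move=> i' _; rewrite supd_neqv.
- by move=> i s' iN [/hb].
- move=> i s' iN [F' ej ev ev']; apply: ht_assign; first by rewrite (he _ i) ?FL ?ev'.
  rewrite (he _ i) ?ev' //= ej; split; first by rewrite supd_neqv // eq_sym.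
  split; rewrite ?supd_eq //.
  + by apply: frame_trans F' _; apply: frame_trans (frame_supd _ _ _ vin) (frame_supd _ _ _ jin).
  + move=> i'; rewrite ltnS supd_neqv // leq_eqVlt => /orP[/eqP->|lt]; first by rewrite supd_eq.
    by rewrite supd_neqi ?ev // ltn_eqF.
  + by move=> i' lt; rewrite supd_neqv // supd_neqi ?gtn_eqF // ev' // ltnW.
- by move=> s' [].
Qed.

End Hoare.

(** * The subgradient step *)

Section Subgradient.
Variables (V : finType) (w : V -> V -> nat).
Hypothesis w_sym : forall u v, w u v = w v u.

(* Ordered pairs: each edge inside [S] is counted twice. *)
Definition wsum (S : {set V}) : nat := \sum_(u in S) \sum_(v in S) w u v.

Definition level (x : V -> nat) (u : V) : {set V} := [set v | x u <= x v].

(* Each edge gives its weight to its endpoint with the smaller [x]. *)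
Definition load (x : V -> nat) (v : V) : nat :=
  \sum_u w v u * ((x v <= x u) + (x v < x u)).

(** Swapping the endpoints in the strict comparisons makes every ordered pair charge exactly once,
    to an endpoint with the smaller [x]; ties are shared evenly. *)
Lemma sum_minor_endpoint (x c : V -> nat) (S : {set V}) :
  \sum_(v in S) c v * (\sum_(u in S) w v u * ((x v <= x u) + (x v < x u))) =
  \sum_(v in S) \sum_(u in S) w v u * (if x v <= x u then c v else c u).
Proof.
transitivity (\sum_(v in S) \sum_(u in S) (w v u * (c v * (x v <= x u))) +
              \sum_(v in S) \sum_(u in S) (w v u * (c v * (x v < x u)))).
  rewrite -big_split /=; apply: eq_bigr => v _; rewrite big_distrr -big_split /=.
  by apply: eq_bigr => u _; nia.
rewrite [X in _ + X]exchange_big /= -big_split; apply: eq_bigr => v _.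
rewrite -big_split; apply: eq_bigr => u _ /=; rewrite (w_sym u v).
by case: leqP => _ /=; nia.
Qed.

(** For [c = 1] the pairs inside [S] contribute exactly [wsum S], and pairs leaving [S] only add.
    This is the subgradient inequality tested at the indicator of [S]. *)
Lemma wsum_le_load x (S : {set V}) : wsum S <= \sum_(v in S) load x v.
Proof.
apply: leq_trans (_ : \sum_(v in S) 1 * (\sum_(u in S) w v u * ((x v <= x u) + (x v < x u))) <= _).
  rewrite (sum_minor_endpoint x (fun=> 1)) /wsum; apply: leq_sum => v _; apply: leq_sum => u _.
  by rewrite if_same muln1.
apply: leq_sum => v _; rewrite mul1n /load [leqRHS](bigID (mem S)) /=; exact: leq_addr.
Qed.

Lemma sum_indicator_lt M z : z <= M -> \sum_(h < M) ((h < z) : nat) = z.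
Proof.
move=> zM; rewrite -(big_mkord xpredT (fun h => (h < z) : nat)) (big_cat_nat (n := z)) //=.
rewrite big_nat (eq_bigr (fun=> 1)) => [|i /andP[_ ->]//].
rewrite -big_nat sum_nat_const_nat subn0 muln1 big_nat big1 ?addn0 // => i /andP[zi _].
by rewrite ltnNge zi.
Qed.

(** For [c = x] each pair is charged the smaller coordinate, which counts the thresholds [h] below
    both. Both sides evaluate the Lovasz extension of [wsum] at [x]. *)
Lemma sum_levels M (x : V -> nat) : (forall v, x v <= M) ->
  \sum_v x v * load x v = \sum_(h < M) wsum [set v | h < x v].
Proof.
have sumT (F : V -> nat) : \sum_(v in setT) F v = \sum_v F v.
  by apply: eq_bigl => v; rewrite inE.
move=> xM; transitivity (\sum_v \sum_u w v u * (if x v <= x u then x v else x u)).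
  have := sum_minor_endpoint x x setT; rewrite !sumT => e.
  by apply: etrans (etrans _ e) _; apply: eq_bigr => v _; rewrite sumT.
transitivity (\sum_v \sum_u \sum_(h < M) w v u * ((h < x v) * (h < x u))).
  apply: eq_bigr => v _; apply: eq_bigr => u _; rewrite -big_distrr /=; congr (_ * _).
  rewrite -(@sum_indicator_lt M (if _ then _ else _)); last by case: ifP.
  apply: eq_bigr => h _.
  by case: (leqP (x v) (x u)) => ?; case: (ltnP h (x v)) => ?; case: (ltnP h (x u)) => ? //=; lia.
under eq_bigr do rewrite exchange_big.
rewrite exchange_big; apply: eq_bigr => h _ /=; rewrite /wsum.
rewrite [RHS]big_mkcond; apply: eq_bigr => v _ /=; rewrite inE.
case: ifP => hv; last by rewrite big1 // => u _; rewrite mul0n muln0.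
rewrite [RHS]big_mkcond; apply: eq_bigr => u _ /=; rewrite inE.
by case: ifP; rewrite ?muln1 ?muln0.
Qed.

Lemma sum_card_levels M (x : V -> nat) : (forall v, x v <= M) ->
  \sum_v x v = \sum_(h < M) #|[set v | h < x v]|.
Proof.
move=> xM; transitivity (\sum_v \sum_(h < M) ((h < x v) : nat)).
  by apply: eq_bigr => v _; rewrite sum_indicator_lt.
rewrite exchange_big; apply: eq_bigr => h _ /=.
by rewrite -sum1dep_card [RHS]big_mkcond; apply: eq_bigr => v _ /=; case: ifP.
Qed.

Lemma wsum0 : wsum set0 = 0.
Proof. by rewrite /wsum big_set0. Qed.

(** A vertex of minimal [x] in the set exhibits it as a [level]. Thus testing one level per vertex
    covers all thresholds. *)
Lemma superlevel_level (x : V -> nat) h v0 : h < x v0 ->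
  exists2 u, h < x u & [set v | h < x v] = level x u.
Proof.
move=> hv0; have [u hu umin] := @arg_minnP _ v0 (fun v => h < x v) x hv0.
exists u => //; apply/setP => v; rewrite !inE; apply/idP/idP => [/umin//|].
exact: leq_trans.
Qed.

Lemma wsum_setT : wsum setT = \sum_u \sum_v w u v.
Proof.
rewrite /wsum; apply: eq_big => [?|u _]; rewrite ?inE //.
by apply: eq_bigl => ?; rewrite inE.
Qed.

Lemma load_le x v : load x v <= 2 * wsum setT.
Proof.
rewrite wsum_setT (bigD1 v) //= mulnDr; apply: leq_trans (leq_addr _ _).
rewrite big_distrr; apply: leq_sum => u _ /=; lia.
Qed.

Variables (n k M B D : nat).
Hypotheses (n_card : #|V| = n) (k_gt0 : 0 < k).

(** Each nonempty threshold set is a level, and then [maxn k #|S| <= #|S| + (k - 1)]. The unit saved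
    by nonemptiness is what makes every step progress. *)
Lemma sum_load_le x :
  (forall v, x v <= M) ->
  (forall u, D * wsum (level x u) <= B * maxn k #|level x u|) ->
  D * (\sum_v x v * load x v) <= B * (\sum_v x v) + M * (B * k.-1).
Proof.
move=> xM lvl; rewrite (sum_levels xM) (sum_card_levels xM) !big_distrr /=.
rewrite -[X in _ + X * _](card_ord M) -sum_nat_const -big_split /=; apply: leq_sum => h _.
have [->|[v0]] := set_0Vmem [set v | h < x v]; first by rewrite wsum0 muln0.
rewrite inE => /superlevel_level[u hu eu]; rewrite eu; apply: leq_trans (lvl u) _.
have : 0 < #|level x u| by apply/card_gt0P; exists u; rewrite inE.
rewrite -mulnDr leq_mul2l; lia.
Qed.

(** Truncated subtraction clips at 0, and [y - (y - M)] is the minimum of [y] and [M]: this projects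
    onto [[0, M]] after a move along [D * load - B], which is [D] times a subgradient for
    [l = B / D]. *)
Definition step (x : V -> nat) (v : V) : nat :=
  x v + D * load x v - B - (x v + D * load x v - B - M).

Definition pot (H : {set V}) (x : V -> nat) : int :=
  (\sum_v ((x v)%:Z - (M * (v \in H))%:Z) ^+ 2)%R.

(** After expanding the squares, the linear terms at the target and at [x] differ by at least
    [M * (B + 1)], while the quadratic term is at most [M * B]. Multiplying by [n] and using
    [wsum setT <= B * n] gives a decrease independent of [B]. *)
Lemma step_pot (H : {set V}) x :
  (forall v, x v <= M) ->
  (forall u, D * wsum (level x u) <= B * maxn k #|level x u|) ->
  k <= #|H| -> 2 * B * #|H| < D * wsum H ->
  D <= n -> B <= wsum setT -> wsum setT <= B * n -> M = 4 * n ^ 4 * wsum setT ->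
  (n%:Z * pot H (step x) + (M * wsum setT)%:Z <= n%:Z * pot H x)%R.
Proof.
move=> xM lvl kH gap Dn BW WBn eM; set W := wsum setT in BW WBn eM *.
pose g v : int := ((D * load x v)%:Z - B%:Z)%R.
(* The target coordinates 0 and [M] lie in [[0, M]], so clipping does not increase the distance. *)
have le1 : (pot H (step x) <= \sum_v ((x v)%:Z + g v - (M * (v \in H))%:Z) ^+ 2)%R.
  apply: ler_sum => v _; rewrite /step /g; have := xM v.
  case: (v \in H); rewrite ?muln1 ?muln0; move: (D * load x v) (x v) => y z; nia.
have exp : (\sum_v ((x v)%:Z + g v - (M * (v \in H))%:Z) ^+ 2 =
   pot H x + 2%:R * (\sum_v g v * (x v)%:Z) - 2%:R * (\sum_v g v * (M * (v \in H))%:Z)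
   + \sum_v g v ^+ 2)%R.
  rewrite /pot !big_distrr -!big_split -sumrN -!big_split /=.
  by apply: eq_bigr => v _; ring.
have s1 : (\sum_v g v * (x v)%:Z <= (M * (B * k.-1))%:Z)%R.
  have := sum_load_le xM lvl.
  have -> : (\sum_v g v * (x v)%:Z = (D * (\sum_v x v * load x v))%:Z - (B * (\sum_v x v))%:Z)%R.
    rewrite !big_distrr !(big_morph Posz PoszD (erefl _)) -sumrN -big_split /=.
    by apply: eq_bigr => v _; rewrite /g !PoszM; ring.
  lia.
(* The subgradient inequality at [H] is combined with the gap, whose strictness over integers gives
   the [+ 1]. *)
have s2 : ((M * (B * k + 1))%:Z <= \sum_v g v * (M * (v \in H))%:Z)%R.
  have -> : (\sum_v g v * (M * (v \in H))%:Z =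
      M%:Z * ((D * (\sum_(v in H) load x v))%:Z - (B * #|H|)%:Z))%R.
    rewrite -sum1_card !big_distrr !(big_morph Posz PoszD (erefl _)) -sumrN -big_split /=.
    rewrite big_distrr [RHS]big_mkcond /=; apply: eq_bigr => v _; rewrite /g.
    by case: (v \in H); rewrite ?muln1 ?muln0 ?mulr0 // !PoszM; ring.
  have lD := leq_mul (leqnn D) (wsum_le_load x H).
  have lB := leq_mul (leqnn B) kH.
  rewrite PoszM ler_wpM2l //; move: (D * _) (D * _) (B * k) gap lD lB => p q r.
  by rewrite -mulnA; lia.
(* Loads are at most [2 * W] and [D <= n], so each [g v] is at most [2 * n * W] in absolute
   value. *)
have s3 : (\sum_v g v ^+ 2 <= (n * (2 * n * W) ^ 2)%:Z)%R.
  have -> : ((n * (2 * n * W) ^ 2)%:Z = \sum_(v : V) ((2 * n * W) ^ 2)%:Z)%R.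
    by rewrite sumr_const n_card PoszM; ring.
  apply: ler_sum => v _; rewrite /g; have := load_le x v; rewrite -/W => lW.
  have : D * load x v <= 2 * n * W by nia.
  have : B <= 2 * n * W by nia.
  move: (D * load x v) (2 * n * W) => y z; nia.
have n0 : 0 < n by rewrite -n_card; exact: leq_trans k_gt0 (leq_trans kH (max_card _)).
(* This dictates the value of [M]: one factor [W] of the quadratic term is traded for [B * n]. *)
have s4 : n * (2 * n * W) ^ 2 <= M * B.
  rewrite eM (_ : n * _ ^ 2 = 4 * n ^ 3 * W * W); last by ring.
  rewrite (_ : 4 * n ^ 4 * W * B = 4 * n ^ 3 * W * (B * n)); last by ring.
  by rewrite leq_mul2l WBn orbT.
have s5 : M * W <= n * (M * B) by nia.
have fin : (pot H (step x) + (M * B)%:Z <= pot H x)%R.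
  apply: Order.POrderTheory.le_trans (_ : _ <= pot H x + (2 * M * (B * k.-1))%:Z - (2 * M * (B * k + 1))%:Z + (2 * (M * B))%:Z)%R _; nia.
nia.
Qed.

End Subgradient.

(** * The program *)

Definition hle e1 e2 := HSub (HC 1) (HSub e1 e2).
Definition hlt e1 e2 := HSub (HC 1) (HSub (HAdd e1 (HC 1)) e2).

Definition sum_loop acc j bnd e := fold_loop acc j bnd (HC 0) (HAdd (hvar acc) e).

Definition hsquare := HMul (hvar VN) (hvar VN).
(** After [n] and [k], numerators occupy the even cells ([c = 2]) and denominators the odd ones
    ([c = 3]). *)
Definition hraw c := HR (HAdd (HC c) (HMul (HC 2) (hvar VJ))).

(** The product of the denominators serves as common multiple: its length is bounded by the input
    size, and no greatest common divisor has to be computed. *)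
Definition integer_weights : cmd :=
  Seq (assign VK (HC 0) (HR (HC 1)))
 (Seq (fold_loop VP VJ hsquare (HC 1) (HMul (hvar VP) (hraw 3)))
      (map_loop AW VJ hsquare (HMul (hraw 2) (HDiv (hvar VP) (hraw 3))))).

Definition initialize : cmd :=
  Seq (sum_loop VW VJ hsquare (HV AW (hvar VJ)))
 (Seq (assign VM (HC 0) (HMul (HMul (HC 4) (HMul hsquare hsquare)) (hvar VW)))
 (Seq (assign VT (HC 0) (HAdd (HMul (HC 4) (HMul hsquare (HMul hsquare hsquare))) (HC 1)))
 (Seq (map_loop AX VJ (hvar VN) (hvar VM))
 (Seq (map_loop AY VJ (hvar VN) (HC 1))
 (Seq (assign VB (HC 0) (hvar VW))
      (assign VD (HC 0) (hvar VN))))))).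

(** [row] and [column] decode an index of the flattened matrix. [k + (c - k)] is the maximum of [k]
    and [c]; the ratios [VV / VE] and [VB / VD] are compared by cross multiplication. *)
Definition test_level : cmd :=
  let inside e := hle (HV AX (hvar VU)) (HV AX e) in
  let row := HDiv (hvar VJ) (hvar VN) in
  let column := HSub (hvar VJ) (HMul row (hvar VN)) in
  Seq (sum_loop VC VJ (hvar VN) (inside (hvar VJ)))
 (Seq (sum_loop VV VJ hsquare (HMul (HV AW (hvar VJ)) (HMul (inside row) (inside column))))
 (Seq (assign VE (HC 0) (HAdd (hvar VK) (HSub (hvar VC) (hvar VK))))
      (If (comp (HSub (HMul (hvar VV) (hvar VD)) (HMul (hvar VB) (hvar VE))))
          (Seq (assign VB (HC 0) (hvar VV))
          (Seq (assign VD (HC 0) (hvar VE))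
               (map_loop AY VJ (hvar VN) (inside (hvar VJ)))))
          Skip))).

Definition scan_levels : cmd := for_loop VU (hvar VN) test_level.

Definition compute_loads : cmd :=
  for_loop VU (hvar VN)
    (Seq (sum_loop VV VJ (hvar VN)
           (HMul (HV AW (HAdd (HMul (hvar VU) (hvar VN)) (hvar VJ)))
                 (HAdd (hle (HV AX (hvar VU)) (HV AX (hvar VJ)))
                       (hlt (HV AX (hvar VU)) (HV AX (hvar VJ))))))
         (assign AG (hvar VU) (hvar VV))).

Definition move_point : cmd :=
  let moved := HSub (HAdd (HV AX (hvar VJ)) (HMul (hvar VD) (HV AG (hvar VJ)))) (hvar VB) in
  map_loop AX VJ (hvar VN) (HSub moved (HSub moved (hvar VM))).

Definition ascent : cmd :=
  for_loop VI (hvar VT) (Seq scan_levels (Seq compute_loads move_point)).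

(** The product tested is nonzero exactly when the vertex is missing and the set still has fewer
    than [k] elements. *)
Definition pad : cmd :=
  Seq (sum_loop VC VJ (hvar VN) (HV AY (hvar VJ)))
      (for_loop VU (hvar VN)
        (If (comp (HMul (HSub (HC 1) (HV AY (hvar VU))) (HSub (hvar VK) (hvar VC))))
            (Seq (assign AY (hvar VU) (HC 1))
                 (assign VC (HC 0) (HAdd (hvar VC) (HC 1))))
            Skip)).

(** Reads unchanged variables in earlier states; non-membership in the frame list is decided by
    computation. *)
Ltac frames := repeat
  match goal with H : frame _ _ ?s |- context [?s ?v] => rewrite (H v (erefl true)) end.

Lemma sum_rectangle m n (F : nat -> nat) :
  \sum_(p < m * n) F p = \sum_(i < m) \sum_(j < n) F (i * n + j).
Proof.
elim: m => [|m IH]; first by rewrite !big_ord0.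
rewrite big_ord_recr /= -IH -!(big_mkord xpredT F).
rewrite (big_cat_nat (n := m * n)) //=; last by rewrite leq_mul2r leqnSn orbT.
congr (_ + _); rewrite -{1}[m * n]add0n big_addn mulSn addnK big_mkord.
by apply: eq_bigr => j _; rewrite addnC.
Qed.

Lemma ratio_trans a b c d e f : 0 < d -> a * d <= c * b -> c * f <= e * d -> a * f <= e * b.
Proof. by move=> d0 h1 h2; rewrite -(leq_pmul2l d0); nia. Qed.

Lemma hleE x y : 1 - (x - y) = (x <= y).
Proof. by case: leqP; lia. Qed.

Lemma hltE x y : 1 - (x + 1 - y) = (x < y).
Proof. by case: ltnP; lia. Qed.

(** * Correctness of the ascent and of the padding *)

Section Specs.
Variables (b : nat) (inp : memory) (L Z : nat).
Hypotheses (b_gt0 : 0 < b) (L_gt0 : 0 < L).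
Hypotheses (b_lt : b < 2 ^ L) (inp_lt : forall x, inp x < 2 ^ L).
Variables (n k : nat) (a : nat -> nat).
Hypothesis kn : 0 < k <= n.

Let w (i j : 'I_n) : nat := a (i * n + j).
Hypothesis w_sym : forall i j, w i j = w j i.

Let W := wsum w setT.
Let M := 4 * n ^ 4 * W.
Let T := (4 * n ^ 6).+1.
Hypotheses (T_ltZ : T < Z) (T_lt : T < 2 ^ L) (M_lt : M < 2 ^ L) (W_lt : 2 * W < 2 ^ L).

Local Notation triple := (ht b inp L Z).

Definition fixed (s : state) :=
  [/\ s VN 0 = n, s VK 0 = k, s VM 0 = M, s VT 0 = T & forall p, p < n * n -> s AW p = a p].

(** The last clause says that the ratio is at least [W / n], that of the whole vertex set from which
    the search starts; it supplies the lower bound on [B] in [step_pot]. *)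
Definition best (s : state) (S : {set 'I_n}) :=
  [/\ forall v : 'I_n, s AY v = (v \in S), s VB 0 = wsum w S,
      s VD 0 = maxn k #|S| & W * s VD 0 <= s VB 0 * n].

Lemma fixed_frame l s s' : fixed s -> frame l s s' ->
  ~~ has (fun v => v \in [:: VN; VK; VM; VT; AW]) l -> fixed s'.
Proof.
move=> [h1 h2 h3 h4 h5] fr /hasPn hl.
have e v : v \in [:: VN; VK; VM; VT; AW] -> s' v = s v.
  by move=> vl; apply: fr; apply/negP => /hl; rewrite vl.
by split; rewrite ?e.
Qed.

Lemma n_gt0 : 0 < n. Proof. by case/andP: kn; apply: leq_trans. Qed.

(** The number of steps thus dominates every other loop length, and one bound [Z] serves all
    loops. *)
Lemma square_le : n * n <= T.
Proof. by rewrite /T (_ : 4 * n ^ 6 = n * n * (4 * n ^ 4)) ?leqW ?leq_pmulr ?muln_gt0 ?expn_gt0 ?n_gt0 //; ring. Qed.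

Lemma n_le : n <= T.
Proof. by apply: leq_trans square_le; rewrite leq_pmulr ?n_gt0. Qed.

Lemma W_sum : W = \sum_(p < n * n) a p.
Proof. by rewrite /W wsum_setT sum_rectangle. Qed.

Lemma wsum_le_W S : wsum w S <= W.
Proof.
rewrite /W wsum_setT /wsum [leqRHS](bigID (mem S)) /=; apply: leq_trans (leq_addr _ _).
by apply: leq_sum => i _; rewrite [leqRHS](bigID (mem S)) /= leq_addr.
Qed.

Lemma wsum_level (x : nat -> nat) (u : 'I_n) :
  \sum_(p < n * n) a p * ((x u <= x (p %/ n)) * (x u <= x (p - p %/ n * n))) =
  wsum w (level (fun v : 'I_n => x v) u).
Proof.
rewrite (sum_rectangle n n (fun p => a p * ((x u <= x (p %/ n)) * (x u <= x (p - p %/ n * n))))).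
rewrite /wsum [RHS]big_mkcond; apply: eq_bigr => i _ /=.
have dv (j : 'I_n) : (i * n + j) %/ n = i by rewrite divnMDl ?n_gt0 // divn_small // addn0.
rewrite inE; case: ifP => xi; last first.
  by rewrite big1 // => j _; rewrite dv xi mul0n muln0.
rewrite [RHS]big_mkcond; apply: eq_bigr => j _ /=.
by rewrite dv xi addKn inE mul1n; case: ifP; rewrite ?muln1 ?muln0.
Qed.

Lemma card_level (x : nat -> nat) (u : 'I_n) :
  \sum_(v < n) ((x u <= x v) : nat) = #|level (fun v : 'I_n => x v) u|.
Proof. by rewrite -sum1dep_card [RHS]big_mkcond; apply: eq_bigr => v _ /=; case: ifP. Qed.

Lemma n_ltL : n < 2 ^ L. Proof. exact: leq_ltn_trans n_le T_lt. Qed.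
Lemma n_ltZ : n < Z. Proof. exact: leq_ltn_trans n_le T_ltZ. Qed.
Lemma square_ltL : n * n < 2 ^ L. Proof. exact: leq_ltn_trans square_le T_lt. Qed.
Lemma square_ltZ : n * n < Z. Proof. exact: leq_ltn_trans square_le T_ltZ. Qed.
Lemma bool_lt (c : bool) : c < 2 ^ L.
Proof. by apply: leq_ltn_trans T_lt; case: c. Qed.

Lemma wsum_lt S : wsum w S < 2 ^ L.
Proof. by apply: leq_ltn_trans (wsum_le_W S) _; apply: leq_ltn_trans W_lt; rewrite leq_pmull. Qed.

Lemma max_card_lt (S : {set 'I_n}) : maxn k #|S| < 2 ^ L.
Proof.
apply: leq_ltn_trans n_ltL; rewrite geq_max; case/andP: kn => _ -> /=.
by rewrite -[leqRHS](card_ord n) max_card.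
Qed.

Hint Resolve n_ltL n_ltZ square_ltL square_ltZ bool_lt : core.

Definition scanned (s : state) (x : nat -> nat) (i : nat) :=
  forall u : 'I_n, u < i ->
    s VD 0 * wsum w (level (fun v : 'I_n => x v) u) <=
    s VB 0 * maxn k #|level (fun v : 'I_n => x v) u|.

(** A replacement only raises the ratio, so the earlier levels still pass, by [ratio_trans], and the
    new one passes with equality. Without replacement, the vanishing truncated difference is the
    inequality required. *)
Lemma test_level_spec s S (u : 'I_n) : fixed s -> best s S -> s VU 0 = u ->
  scanned s (s AX) u ->
  triple test_level s (fun s' =>
    [/\ frame [:: VJ; VC; VV; VE; VB; VD; AY] s s', exists S', best s' S',
        s VB 0 * s' VD 0 <= s' VB 0 * s VD 0 & scanned s' (s AX) u.+1]).
Proof.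
move=> fs bs eu sc; set x := s AX; set lv := level (fun v : 'I_n => x v) u.
have [eN eK eM eT eA] := fs.
have D0 s' S' : best s' S' -> 0 < s' VD 0.
  by case=> _ _ -> _; case/andP: kn => k0 _; apply: leq_trans k0 (leq_maxl _ _).
apply: ht_seq; apply: ht_conseq; last first.
  apply: (@ht_sum _ _ _ _ _ _ _ _ (fun v => (x u <= x v) : nat) n) => //=.
  - by rewrite card_level; apply: leq_ltn_trans (max_card _) _; rewrite card_ord.
  - by move=> s' f; frames.
  - by move=> s' i ni f ej; frames; rewrite eu ej hleE.
move=> s1 [f1]; rewrite card_level -/lv => eC.
apply: ht_seq; apply: ht_conseq; last first.
  apply: (@ht_sum _ _ _ _ _ _ _ _ (fun p => a p * ((x u <= x (p %/ n)) * (x u <= x (p - p %/ n * n)))) (n * n)) => //=.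
  - by rewrite wsum_level wsum_lt.
  - by move=> s' f; frames; rewrite eN.
  - by move=> s' i ni f ej; frames; rewrite eu ej eN eA // !hleE.
move=> s2 [f2]; rewrite wsum_level -/lv => eV.
apply: ht_seq; apply: (@ht_set _ _ _ _ _ _ _ _ (maxn k #|lv|)) => //.
- by rewrite /=; frames; rewrite eC eK -maxnE.
- exact: max_card_lt.
set s3 := supd _ _ _ _.
have f3 : frame [:: VJ; VC; VV; VE] s s3.
  apply: frame_trans (_ : frame _ s s1) _; first by apply: frame_sub f1; case.
  apply: frame_trans (_ : frame _ s1 s2) _; first by apply: frame_sub f2 ; case.
  exact: frame_supd.
have e3V : s3 VV 0 = wsum w lv by rewrite /s3 /supd /=.
have e3E : s3 VE 0 = maxn k #|lv| by rewrite /s3 /supd /=.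
clearbody s3; apply: ht_if => //=; frames; rewrite e3V e3E => cond.
- apply: ht_seq; apply: (@ht_set _ _ _ _ _ _ _ _ (wsum w lv)) => //; first exact: wsum_lt.
  apply: ht_seq; apply: (@ht_set _ _ _ _ _ _ _ _ (maxn k #|lv|)) => //; first exact: max_card_lt.
  set s4 := supd (supd _ _ _ _) _ _ _.
  have f4 : frame [:: VB; VD] s3 s4.
    by apply: frame_trans (frame_supd _ _ _ _) (frame_supd _ _ _ _).
  apply: ht_conseq; last first.
    apply: (@ht_map _ _ _ _ _ _ _ _ (fun v => (x u <= x v) : nat) n) => //=.
    + by move=> s' f; frames.
    + by move=> s' i ni f ej _; frames; rewrite eu ej hleE.
  move=> s5 [f5 eY].
  have eB : s5 VB 0 = wsum w lv by frames; rewrite /s4 /supd /=.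
  have eD : s5 VD 0 = maxn k #|lv| by frames; rewrite /s4 /supd /=.
  have imp : s VB 0 * s5 VD 0 < s5 VB 0 * s VD 0 by rewrite eB eD; lia.
  split.
  + apply: frame_trans (_ : frame _ s s3) _; first by apply: frame_sub f3 ; case.
    apply: frame_trans (_ : frame _ s3 s4) _; first by apply: frame_sub f4 ; case.
    by apply: frame_sub f5 ; case.
  + exists lv; split=> //; first by move=> v; rewrite eY // inE.
    by case: (bs) => _ _ _ h; apply: ratio_trans (D0 _ _ bs) h (ltnW imp).
  + exact: ltnW.
  + move=> v; rewrite ltnS leq_eqVlt => /orP[/eqP ev|vu].
      by rewrite eB eD (ord_inj ev) mulnC.
    rewrite mulnC; apply: ratio_trans (D0 _ _ bs) _ (ltnW imp).
    by rewrite mulnC; apply: sc.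
- apply: ht_skip => //; split.
  + by apply: frame_sub f3 ; case.
  + by exists S; case: bs => ? ? ? ?; split; frames.
  + by frames; rewrite mulnC.
  + move=> v; rewrite ltnS leq_eqVlt; frames => /orP[/eqP ev|vu]; last exact: sc.
    by move/eqP: cond; rewrite subn_eq0 (ord_inj ev) mulnC.
Qed.

Lemma scan_levels_spec s S : fixed s -> best s S ->
  triple scan_levels s (fun s' =>
    [/\ frame [:: VU; VJ; VC; VV; VE; VB; VD; AY] s s', exists S', best s' S',
        s VB 0 * s' VD 0 <= s' VB 0 * s VD 0 & scanned s' (s AX) n]).
Proof.
move=> fs bs.
pose Inv i s' := [/\ frame [:: VU; VJ; VC; VV; VE; VB; VD; AY] s s', s' VU 0 = i,
  exists S', best s' S', s VB 0 * s' VD 0 <= s' VB 0 * s VD 0 & scanned s' (s AX) i].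
apply: (@ht_for _ _ _ _ _ _ _ _ Inv n) => //.
- by split; [exact: frame_supd | exact: supd_eq | exists S | rewrite /supd /= leqnn | move=> ? ].
- move=> i s' iN [f eu _ _ _]; split=> //=; frames; by case: fs.
- move=> i s' iN [f eu [S' bs'] imp sc].
  have fs' : fixed s' by apply: fixed_frame fs f _.
  apply: ht_conseq; last first.
    apply: (@test_level_spec s' S' (Ordinal iN)) => //; frames; exact: sc.
  move=> s2 [f2 [S2 bs2] imp2 sc2]; have := sc2; rewrite (f AX) //= => sc2'.
  split; first by frames.
  split.
  + apply: frame_trans f _; apply: frame_trans (frame_supd _ _ _ _) => //.
    by apply: frame_sub f2; case.
  + exact: supd_eq.
  + by exists S2.
  + rewrite /supd /=; apply: ratio_trans imp imp2.
    by case: bs' => _ _ -> _; case/andP: kn => k0 _; apply: leq_trans k0 (leq_maxl _ _).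
  + exact: sc2'.
- by move=> s' [].
Qed.

Lemma compute_loads_spec s : fixed s ->
  triple compute_loads s (fun s' => frame [:: VU; VJ; VV; AG] s s' /\
    forall u : 'I_n, s' AG u = load w (fun v : 'I_n => s AX v) u).
Proof.
move=> fs; set x := s AX.
pose Inv i s' := [/\ frame [:: VU; VJ; VV; AG] s s', s' VU 0 = i
  & forall u : 'I_n, u < i -> s' AG u = load w (fun v : 'I_n => x v) u].
apply: (@ht_for _ _ _ _ _ _ _ _ Inv n) => //.
- by split; [exact: frame_supd | exact: supd_eq | move=> ?].
- move=> i s' iN [f eu _]; split=> //=; frames; by case: fs.
- move=> i s' iN [f eu ld]; pose u := Ordinal iN.
  have [eN eK eM eT eA] := fs.
  pose F j := a (i * n + j) * ((x i <= x j) + (x i < x j)).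
  have eF : \sum_(j < n) F j = load w (fun v : 'I_n => x v) u by [].
  have lF : \sum_(j < n) F j < 2 ^ L by rewrite eF; apply: leq_ltn_trans (load_le _ _ _) W_lt.
  apply: ht_seq; apply: ht_conseq; last first.
    apply: (@ht_sum _ _ _ _ _ _ _ _ F n) => //=; first by move=> s1 f1; frames.
    move=> s1 j jn f1 ej; rewrite (f1 VU) // eu; frames; rewrite hleE hltE ej eN eA //.
    apply: leq_trans (_ : i.+1 * n <= _); last by rewrite leq_mul2r iN orbT.
    by rewrite mulSn addnC ltn_add2r.
  move=> s1 [f1 eV]; apply: ht_assign => //=; rewrite eV // eF (f1 VU) // eu.
  split; first by rewrite supd_neqv // (f1 VU).
  split.
  + apply: frame_trans f _; apply: frame_trans (frame_supd _ _ _ _) => //.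
    apply: frame_trans (frame_supd _ _ _ _) => //; by apply: frame_sub f1; case.
  + exact: supd_eq.
  + move=> v; rewrite ltnS supd_neqv // leq_eqVlt => /orP[/eqP ev|vu].
      by rewrite (_ : v = u) ?supd_eq //; apply: ord_inj.
    by rewrite supd_neqi ?ltn_eqF // (f1 AG) // ld.
- by move=> s' [f _ h]; split=> // u; apply: h.
Qed.

Lemma move_point_spec s : fixed s ->
  (forall u : 'I_n, s AG u = load w (fun v : 'I_n => s AX v) u) ->
  triple move_point s (fun s' => frame [:: AX; VJ] s s' /\
    forall v : 'I_n, s' AX v = step w M (s VB 0) (s VD 0) (fun v : 'I_n => s AX v) v).
Proof.
move=> [eN eK eM eT eA] ld.
pose F v := let y := s AX v + s VD 0 * s AG v - s VB 0 in y - (y - M).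
apply: ht_conseq; last first.
  apply: (@ht_map _ _ _ _ _ _ _ _ F n) => //=.
  - by move=> i _; apply: leq_ltn_trans M_lt; rewrite /F /=; lia.
  - by move=> s' f; frames.
  - by move=> s' i iN f ej ex; rewrite /F ej ex; frames; rewrite eM.
by move=> s' [f e]; split=> // v; rewrite e // /F ld.
Qed.

(** The factor 2 is the approximation ratio; counting edges twice affects both sides alike. *)
Definition optimal (s : state) :=
  forall H : {set 'I_n}, k <= #|H| -> s VD 0 * wsum w H <= 2 * s VB 0 * #|H|.

(** The distance bound is claimed only for sets [H] whose density is still more than twice the
    current ratio. As the ratio never decreases, this was so at all earlier steps, and each of them
    has paid its decrease. *)
Definition ascending (t : nat) (s : state) :=
  [/\ fixed s, s VI 0 = t, forall v : 'I_n, s AX v <= M, exists S, best s S &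
  forall H : {set 'I_n}, k <= #|H| -> 2 * s VB 0 * #|H| < s VD 0 * wsum w H ->
    (n%:Z * pot M H (fun v : 'I_n => s AX v) + (t * (M * W))%:Z <= (n * n * M ^ 2)%:Z)%R].

Lemma ascending_step t s : ascending t s ->
  triple (Seq scan_levels (Seq compute_loads move_point)) s
    (fun s' => s' VI 0 = t /\ ascending t.+1 (supd s' VI 0 t.+1)).
Proof.
move=> [fs et xM [S bs] dec].
apply: ht_seq; apply: ht_conseq (scan_levels_spec fs bs) => s1 [f1 [S1 bs1] imp sc].
have fs1 : fixed s1 by apply: fixed_frame fs f1 _.
apply: ht_seq; apply: ht_conseq (compute_loads_spec fs1) => s2 [f2 ld].
have fs2 : fixed s2 by apply: fixed_frame fs1 f2 _.
rewrite (f1 AX) // -(f1 AX) // -(f2 AX) // in ld.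
apply: ht_conseq (move_point_spec fs2 ld) => s3 [f3 ex].
have fs3 : fixed s3 by apply: fixed_frame fs2 f3 _.
have e3I : s3 VI 0 = t by frames.
have eX : s2 AX = s AX by frames.
have eB : s3 VB 0 = s1 VB 0 by frames.
have eD : s3 VD 0 = s1 VD 0 by frames.
rewrite eX (f2 VB) // (f2 VD) // in ex.
split=> //; split.
- by apply: fixed_frame fs3 (frame_supd (l := [:: VI]) _ _ _ _) _.
- exact: supd_eq.
- by move=> v; rewrite supd_neqv // ex /step; lia.
- by exists S1; case: bs1 => h1 h2 h3 h4; split; rewrite /supd /=; frames.
move=> H kH; rewrite !supd_neqv // eB eD => gap.
have [_ b1B b1D b1W] := bs1.
have D1 : 0 < s1 VD 0 by rewrite b1D; case/andP: kn => k0 _; apply: leq_trans k0 (leq_maxl _ _).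
(* Otherwise the old ratio, hence by [imp] the new one, would already reach half the density of
   [H]. *)
have gap0 : 2 * s VB 0 * #|H| < s VD 0 * wsum w H.
  rewrite ltnNge; apply/negP => le0; move: gap; rewrite ltnNge => /negP[].
  rewrite mulnC [2 * _]mulnC -mulnA; apply: ratio_trans imp; last first.
    by rewrite mulnC mulnA [_ * 2]mulnC.
  by case: bs => _ _ -> _; case/andP: kn => k0 _; apply: leq_trans k0 (leq_maxl _ _).
have -> : pot M H (fun v : 'I_n => supd s3 VI 0 t.+1 AX v) =
          pot M H (step w M (s1 VB 0) (s1 VD 0) (fun v : 'I_n => s AX v)).
  by apply: eq_bigr => v _; rewrite supd_neqv // ex.
case/andP: (kn) => k0 kn'.
have dn : s1 VD 0 <= n by rewrite b1D geq_max kn' -[leqRHS](card_ord n) max_card.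
have BW : s1 VB 0 <= W by rewrite b1B wsum_le_W.
have WB : W <= s1 VB 0 * n by apply: leq_trans b1W; rewrite leq_pmulr.
have dec1 := step_pot w_sym (card_ord n) k0 xM (fun u => sc u (ltn_ord u)) kH gap dn BW WB (erefl M).
apply: le_trans (dec H kH gap0); rewrite mulSn PoszD addrA lerD2r.
exact: dec1.
Qed.

Lemma ascent_spec s S : fixed s -> best s S -> (forall v, v < n -> s AX v = M) ->
  triple ascent s (fun s' => [/\ fixed s', exists S', best s' S' & optimal s']).
Proof.
move=> fs bs ex.
apply: (@ht_for _ _ _ _ _ _ _ _ ascending T) => //.
- split.
  + by apply: fixed_frame fs (frame_supd (l := [:: VI]) _ _ _ _) _.
  + exact: supd_eq.
  + by move=> v; rewrite supd_neqv // ex.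
  + by exists S.
  + move=> H _ _; rewrite mul0n addr0 (_ : n * n * M ^ 2 = n * (n * M ^ 2)); last by ring.
    rewrite PoszM ler_wpM2l //.
    have -> : ((n * M ^ 2)%:Z = \sum_(v : 'I_n) (M ^ 2)%:Z)%R.
      by rewrite sumr_const card_ord PoszM; ring.
    apply: ler_sum => v _; rewrite supd_neqv // ex //.
    by case: (v \in H); rewrite ?muln1 ?muln0; nia.
- by move=> i s' _ [[? ? ? ? ?] ? _ _ _]; split.
- by move=> i s' _; apply: ascending_step.
- move=> s' [fs' _ _ bs' dec]; split=> // H kH; rewrite leqNgt; apply/negP => gap.
  have := dec H kH gap; have p0 : (0 <= pot M H (fun v : 'I_n => s' AX v))%R.
    by apply: sumr_ge0 => v _; exact: sqr_ge0.
  (* The gap forces a positive weight, so [M] and the decrease per step are positive too. *)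
  have W0 : 0 < W.
    apply: leq_trans (wsum_le_W H); rewrite lt0n; apply/negP => /eqP w0.
    by rewrite w0 muln0 ltn0 in gap.
  have le1 : (0 <= n%:Z * pot M H (fun v : 'I_n => s' AX v))%R by rewrite mulr_ge0.
  have M0 : 0 < M by rewrite /M muln_gt0 W0 muln_gt0 expn_gt0 n_gt0.
  (* Since [n ^ 2 * M = 4 * n ^ 6 * W], the extra unit in [T] makes the total decrease exceed the
     initial bound. *)
  have lt2 : n * n * M ^ 2 < T * (M * W).
    rewrite (_ : n * n * M ^ 2 = M * (n * n * (4 * n ^ 4 * W))); last by rewrite -/M; ring.
    rewrite (_ : T * (M * W) = M * (T * W)); last by ring.
    rewrite ltn_pmul2l // (_ : n * n * _ = 4 * n ^ 6 * W); last by ring.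
    by rewrite ltn_pmul2r.
  move=> le2; suff : ((T * (M * W))%:Z <= (n * n * M ^ 2)%:Z)%R by rewrite lez_nat leqNgt lt2.
  by apply: le_trans le2; rewrite lerDr.
Qed.

Lemma pad_spec s S : fixed s -> best s S ->
  triple pad s (fun s' => s' VN 0 = n /\ exists S' : {set 'I_n},
    [/\ S \subset S', #|S'| = maxn k #|S| & forall v : 'I_n, s' AY v = (v \in S')]).
Proof.
move=> fs [eY _ _ _]; have [eN eK eM eT eA] := fs.
have eS : \sum_(v < n) s AY v = #|S|.
  by rewrite -sum1_card [RHS]big_mkcond; apply: eq_bigr => v _; rewrite eY; case: ifP.
have cn (S' : {set 'I_n}) : #|S'| <= n by rewrite -[leqRHS](card_ord n) max_card.
apply: ht_seq; apply: ht_conseq; last first.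
  apply: (@ht_sum _ _ _ _ _ _ _ _ (s AY) n) => //=.
  - by rewrite eS; apply: leq_ltn_trans (cn S) n_ltL.
  - by move=> s' f; frames.
  - by move=> s' i iN f ej; frames; rewrite ej.
move=> s1 [f1]; rewrite eS => eC.
(* As long as the set has fewer than [k] elements, it contains every vertex visited. A full pass
   ending below [k] would thus have collected all [n >= k] vertices. *)
pose Inv i s' := [/\ frame [:: VU; VJ; VC; AY] s s', s' VU 0 = i &
  exists S' : {set 'I_n}, [/\ S \subset S', s' VC 0 = #|S'|, #|S'| <= maxn k #|S|,
    forall v : 'I_n, s' AY v = (v \in S') & #|S'| < k -> forall v : 'I_n, v < i -> v \in S']].
apply: (@ht_for _ _ _ _ _ _ _ _ Inv n) => //.
- split; [|exact: supd_eq|].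
    by apply: frame_trans (frame_supd _ _ _ _) => //; apply: frame_sub f1; case.
  by exists S; split; rewrite ?leq_maxr //= => v; rewrite supd_neqv // (f1 AY).
- by move=> i s' iN [f eu _]; split=> //=; frames.
- move=> i s' iN [f eu [S' [sub eC' leC eY' all]]]; pose u := Ordinal iN.
  have eYu : s' AY i = (u \in S') by rewrite -eY'.
  apply: ht_if => //=; rewrite eu eYu eC' (f VK) // eK.
  + case: (boolP (u \in S')) => // uS; rewrite mul1n -lt0n subn_gt0 => Ck.
    apply: ht_seq; apply: ht_assign => //=; first exact: (bool_lt true).
    rewrite eu; apply: (@ht_set _ _ _ _ _ _ _ _ #|S'|.+1) => //=.
    * by rewrite supd_neqv // eC' addn1.
    * by apply: leq_ltn_trans Ck _; apply: leq_ltn_trans n_ltL; case/andP: kn.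
    split; first by rewrite !supd_neqv.
    split; [|exact: supd_eq|].
      by apply: frame_trans f _; do ?apply: frame_trans (frame_supd _ _ _ _).
    have cu : #|u |: S'| = #|S'|.+1 by rewrite cardsU1 uS.
    exists (u |: S'); split.
    * by apply: subset_trans sub (subsetUr _ _).
    * by rewrite supd_neqv // supd_eq cu.
    * by rewrite cu leq_max Ck.
    * move=> v; rewrite supd_neqv // supd_neqv // !inE; have [->|ne] := eqVneq v u; first by rewrite supd_eq.
      by rewrite supd_neqi ?eY'.
    * move=> _ v; rewrite ltnS leq_eqVlt !inE => /orP[/eqP ev|vi]; last by rewrite all ?orbT.
      by rewrite (_ : v = u) ?eqxx //; apply: ord_inj.
  + move=> c0; apply: ht_skip => //; split=> //; split; [|exact: supd_eq|].
      by apply: frame_trans f _; apply: frame_supd.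
    exists S'; split=> // Ck v; rewrite ltnS leq_eqVlt => /orP[/eqP ev|vi]; last exact: all.
    rewrite (_ : v = u); last exact: ord_inj.
    by move: c0; case: (u \in S') => //=; rewrite mul1n => /eqP; rewrite subn_eq0 leqNgt Ck.
- move=> s' [f _ [S' [sub eC' leC eY' all]]]; split; first by frames.
  exists S'; split=> //; apply/eqP; rewrite eqn_leq leC geq_max (subset_leq_card sub) andbT.
  rewrite leqNgt; apply/negP => Ck.
  have : S' = setT by apply/setP => v; rewrite inE all.
  by move=> eT'; move: Ck; rewrite eT' cardsT card_ord ltnNge; case/andP: kn => _ ->.
Qed.

Lemma initialize_spec s : s VN 0 = n -> s VK 0 = k ->
  (forall p, p < n * n -> s AW p = a p) ->
  triple initialize s (fun s' =>
    [/\ fixed s', best s' setT & forall v, v < n -> s' AX v = M]).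
Proof.
move=> eN eK eA.
have WL : W < 2 ^ L by exact: wsum_lt.
apply: ht_seq; apply: ht_conseq; last first.
  apply: (@ht_sum _ _ _ _ _ _ _ _ a (n * n)) => //=.
  - by rewrite -W_sum.
  - by move=> s' f; frames; rewrite eN.
  - by move=> s' i iN f ej; frames; rewrite ej eA.
move=> s1 [f1]; rewrite -W_sum => eW.
apply: ht_seq; apply: (@ht_set _ _ _ _ _ _ _ _ M) => //.
  by rewrite /= eW; frames; rewrite eN /M; ring.
set s2 := supd _ _ _ _.
have f2 : frame [:: VM] s1 s2 by exact: frame_supd.
have e2M : s2 VM 0 = M by exact: supd_eq.
clearbody s2; apply: ht_seq; apply: (@ht_set _ _ _ _ _ _ _ _ T) => //.
  by rewrite /=; frames; rewrite eN /T; ring.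
set s3 := supd _ _ _ _.
have f3 : frame [:: VT] s2 s3 by exact: frame_supd.
have e3T : s3 VT 0 = T by exact: supd_eq.
clearbody s3; apply: ht_seq; apply: ht_conseq; last first.
  apply: (@ht_map _ _ _ _ _ _ _ _ (fun=> M) n) => //=.
  - by move=> s' f; frames.
  - by move=> s' i iN f ej _; frames.
move=> s4 [f4 e4]; apply: ht_seq; apply: ht_conseq; last first.
  apply: (@ht_map _ _ _ _ _ _ _ _ (fun=> 1) n) => //=.
  - by move=> i _; exact: (bool_lt true).
  - by move=> s' f; frames.
move=> s5 [f5 e5]; apply: ht_seq; apply: (@ht_set _ _ _ _ _ _ _ _ W) => //.
  by rewrite /=; frames.
set s6 := supd _ _ _ _.
have f6 : frame [:: VB] s5 s6 by exact: frame_supd.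
have e6B : s6 VB 0 = W by exact: supd_eq.
clearbody s6; apply: (@ht_set _ _ _ _ _ _ _ _ n) => //; first by rewrite /=; frames.
set s7 := supd _ _ _ _.
have f7 : frame [:: VD] s6 s7 by exact: frame_supd.
have e7D : s7 VD 0 = n by exact: supd_eq.
clearbody s7; split.
- by split; frames => // p pn; frames; rewrite eA.
- split; rewrite ?e7D.
  + by move=> v; rewrite inE; frames; rewrite e5.
  + by frames.
  + by rewrite cardsT card_ord; apply/esym/maxn_idPr; case/andP: kn.
  + by frames; rewrite e6B.
- by move=> v vn; frames; rewrite e4.
Qed.

End Specs.

(** * Clearing denominators *)

Section IntegerWeights.
Variables (inp : memory) (L Z n : nat).
Let b := 2 + 2 * (n * n).
Let num p := inp (2 + 2 * p).
Let den p := inp (3 + 2 * p).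
Let P := \prod_(p < n * n) den p.
Hypotheses (L_gt0 : 0 < L) (b_lt : b < 2 ^ L) (inp_lt : forall x, inp x < 2 ^ L).
Hypotheses (square_ltZ : n * n < Z).
Hypothesis prod_lt : forall i, i <= n * n -> \prod_(p < i) den p < 2 ^ L.
Hypothesis weight_lt : forall p, p < n * n -> num p * (P %/ den p) < 2 ^ L.

Lemma integer_weights_spec s : s VN 0 = n ->
  ht b inp L Z integer_weights s (fun s' =>
    [/\ s' VN 0 = n, s' VK 0 = inp 1 & forall p, p < n * n -> s' AW p = num p * (P %/ den p)]).
Proof.
move=> eN.
have b0 : 0 < b by [].
have nL : n * n < 2 ^ L by apply: ltn_trans b_lt; rewrite /b; lia.
have raw s' x : 0 < x < b -> mem_of b inp s' x = inp x.
  by case/andP=> x0 xb; rewrite /mem_of xb gtn_eqF.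
have nums s' p : p < n * n -> mem_of b inp s' (2 + 2 * p) = num p.
  by move=> pn; apply: raw; rewrite /b; lia.
have dens s' p : p < n * n -> mem_of b inp s' (3 + 2 * p) = den p.
  by move=> pn; apply: raw; rewrite /b; lia.
apply: ht_seq; apply: (@ht_set _ _ _ _ _ _ _ _ (inp 1)) => //.
set s1 := supd _ _ _ _.
have f1 : frame [:: VK] s s1 by exact: frame_supd.
have e1 : s1 VK 0 = inp 1 by exact: supd_eq.
clearbody s1; apply: ht_seq; apply: ht_conseq; last first.
  apply: (@ht_fold _ _ _ _ _ _ _ _ (fun i => \prod_(p < i) den p) (n * n)) => //=.
  - by rewrite big_ord0.
  - by move=> s' f; frames; rewrite eN.
  - by move=> s' i iN f ej ep; rewrite ep ej dens // big_ord_recr.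
move=> s2 [f2 e2]; apply: ht_conseq; last first.
  apply: (@ht_map _ _ _ _ _ _ _ _ (fun p => num p * (P %/ den p)) (n * n)) => //=.
  - by move=> s' f; frames; rewrite eN.
  - by move=> s' i iN f ej _; rewrite ej nums // dens //; frames; rewrite e2.
by move=> s3 [f3 e3]; split=> //; frames.
Qed.

End IntegerWeights.

(* Cell 0 comes last, since it gives access to the variables. *)
Definition write_output : cmd :=
  Seq (assign VJ (HC 0) (HC 1))
 (Seq (While (comp (HSub (hvar VN) (hvar VJ)))
        (Seq (Store (comp (hvar VJ)) (comp (HV AY (hvar VJ))))
             (assign VJ (HC 0) (HAdd (hvar VJ) (HC 1)))))
      (Store (ECst 0) (comp (HV AY (HC 0))))).

Lemma exec_store_eq e1 e2 m x y : eval m e1 = x -> eval m e2 = y ->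
  exec (Store e1 e2) m (ecost m e1 + ecost m e2) (upd m x y).
Proof. by move=> <- <-; exact: exec_store. Qed.

Lemma while_cost L A C x y z r : x <= L * A -> y <= L * C -> z <= L * (r.+1 * (A + C)) ->
  x + y + z <= L * (r.+2 * (A + C)).
Proof. by rewrite [r.+2 * _]mulSn !mulnDr => hx hy hz; rewrite !leq_add. Qed.

(** * Copying the result to the low cells *)

Section Output.
Variables (b n L Z : nat).
Hypotheses (n_gt0 : 0 < n) (n_le : n <= b) (n_ltZ : n < Z).
Hypotheses (L_gt0 : 0 < L) (b_lt : b < 2 ^ L).

Lemma upd_mem_of_inp inp s x y : 0 < x < b ->
  upd (mem_of b inp s) x y = mem_of b (upd inp x y) s.
Proof.
case/andP=> x0 xb; apply: functional_extensionality => z; rewrite /upd /mem_of.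
by case: eqP => // ->; rewrite gtn_eqF // xb.
Qed.

(** Stores now change the input block, which [ht] keeps fixed, so the loop is executed directly.
    Cell 0 still holds [b], and the variables remain readable. *)
Lemma write_output_loop r i inp s : n - i = r -> 0 < i <= n ->
  (forall x, inp x < 2 ^ L) -> bounded L s -> s VN 0 = n -> s VJ 0 = i ->
  (forall v, 0 < v < i -> inp v = s AY v) ->
  let e := comp (HSub (hvar VN) (hvar VJ)) in
  let c := Seq (Store (comp (hvar VJ)) (comp (HV AY (hvar VJ))))
               (assign VJ (HC 0) (HAdd (hvar VJ) (HC 1))) in
  exists t inp' s',
    [/\ exec (While e c) (mem_of b inp s) t (mem_of b inp' s'),
        t <= L * (r.+1 * (eweight e + cweight Z c)),
        forall x, mem_of b inp' s' x < 2 ^ L, s' AY = s AY &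
        forall v, 0 < v < n -> inp' v = s AY v].
Proof.
move=> Er /andP[i0 iN] inpL sL eN eJ out e c.
have b0 : 0 < b by apply: leq_trans n_le.
have ev inp0 s0 : eval (mem_of b inp0 s0) e = s0 VN 0 - s0 VJ 0 by rewrite eval_comp.
elim: r i inp s Er i0 iN inpL sL eN eJ out => [|r IH] i inp s Er i0 iN inpL sL eN eJ out;
  have mL := mem_of_lt b_lt inpL sL; have ce := ecost_le e L_gt0 mL.
  have ei : i = n by lia.
  exists (ecost (mem_of b inp s) e), inp, s; split=> //.
  - by apply: exec_while_false; rewrite ev eN eJ.
  - by apply: leq_trans ce _; rewrite leq_mul2l mul1n leq_addr orbT.
  - by rewrite -{1}ei.
have iN' : i < n by lia.
have Er' : n - i.+1 = r by lia.
pose inp1 := upd inp i (s AY i).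
have inp1L x : inp1 x < 2 ^ L by rewrite /inp1 /upd; case: ifP.
have [] := @ht_set b inp1 L Z b0 L_gt0 b_lt inp1L i.+1 VJ (HAdd (hvar VJ) (HC 1)) s
  (fun s' => s' = supd s VJ 0 i.+1) => //; first by rewrite /= eJ addn1.
  by apply: leq_ltn_trans b_lt; apply: leq_trans n_le.
move=> t2 [s2 [ex2 le2 s2L es2]].
have [t3 [inp3 [s3 [ex3 le3 m3L eY out3]]]] : exists t inp' s',
    [/\ exec (While e c) (mem_of b inp1 s2) t (mem_of b inp' s'),
        t <= L * (r.+1 * (eweight e + cweight Z c)),
        forall x, mem_of b inp' s' x < 2 ^ L, s' AY = s2 AY &
        forall v, 0 < v < n -> inp' v = s2 AY v].
  apply: (IH i.+1) => //; rewrite es2 ?supd_eq //.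
  move=> v /andP[v0]; rewrite ltnS supd_neqv // /inp1 /upd leq_eqVlt.
  by case: eqP => [->//|_] /= vi; apply: out; rewrite v0.
have e2Y : s2 AY = s AY by rewrite es2.
pose t1 := ecost (mem_of b inp s) (comp (hvar VJ)) + ecost (mem_of b inp s) (comp (HV AY (hvar VJ))).
exists (ecost (mem_of b inp s) e + (t1 + t2) + t3), inp3, s3; split=> //; rewrite -?e2Y //.
- apply: exec_while_true ex3; first by rewrite ev eN eJ subn_eq0 -ltnNge.
  apply: exec_seq ex2.
  rewrite -upd_mem_of_inp ?i0 ?(leq_trans iN' n_le) //.
  by apply: exec_store_eq; rewrite eval_comp //= eJ.
- have l1 := ecost_le (comp (hvar VJ)) L_gt0 mL.
  have l2 := ecost_le (comp (HV AY (hvar VJ))) L_gt0 mL.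
  have l12 := leq_add (leq_add l1 l2) le2.
  by apply: while_cost ce _ le3; rewrite -!mulnDr in l12.
Qed.

Lemma write_output_spec inp s : (forall x, inp x < 2 ^ L) -> bounded L s -> s VN 0 = n ->
  exists t m, [/\ exec write_output (mem_of b inp s) t m,
    t <= L * cweight Z write_output & forall v, v < n -> m v = s AY v].
Proof.
move=> inpL sL eN.
have b0 : 0 < b by apply: leq_trans n_le.
have [] := @ht_set b inp L Z b0 L_gt0 b_lt inpL 1 VJ (HC 1) s
  (fun s' => s' = supd s VJ 0 1) => //.
  by rewrite -{1}(expn0 2) ltn_exp2l.
move=> t1 [s1 [ex1 le1 s1L es1]].
have [] := @write_output_loop (n - 1) 1 inp s1 => //; rewrite ?es1 ?supd_eq //.
  by case=> // v /andP[].
rewrite -es1.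
set e := comp _; set c := Seq _ _ => t2 [inp2 [s2 [ex2 le2 m2L eY out]]].
have e1Y : s1 AY = s AY by rewrite es1.
pose m2 := mem_of b inp2 s2.
exists (t1 + (t2 + (ecost m2 (ECst 0) + ecost m2 (comp (HV AY (HC 0)))))).
exists (upd m2 0 (s AY 0)); split.
- apply: exec_seq ex1 _; apply: exec_seq ex2 _; apply: exec_store_eq => //.
  by rewrite eval_comp //= eY e1Y.
- have lw : t2 <= L * (Z * (eweight e + cweight Z c)).
    by apply: leq_trans le2 _; rewrite subn1 prednK // leq_pmul2l // leq_mul // ltnW.
  have l3 := leq_add (ecost_le (ECst 0) L_gt0 m2L) (ecost_le (comp (HV AY (HC 0))) L_gt0 m2L).
  by have := leq_add le1 (leq_add lw l3); rewrite -!mulnDr.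
- move=> v vn; rewrite /upd; case: eqP => [->//|/eqP v0].
  rewrite -lt0n in v0; rewrite /m2 /mem_of gtn_eqF // (leq_trans vn n_le) out ?v0 //.
  by rewrite e1Y.
Qed.

End Output.

(* The input occupies the cells below [2 + 2 n^2]; no low cell is free, so the
   address of the variables replaces n in cell 0. *)
Definition base_expr : expr :=
  EAdd (ECst 2) (EMul (ECst 2) (EMul (EGet (ECst 0)) (EGet (ECst 0)))).

Definition algorithm : cmd :=
  Seq (Seq (Store base_expr (EGet (ECst 0))) (Store (ECst 0) base_expr))
 (Seq (Seq integer_weights (Seq initialize (Seq ascent pad)))
      write_output).

(** Address [b] is entry 0 of [VN], whose code is 0, so saving [n] there initializes that
    variable. *)
Definition init_state (n : nat) : state :=
  fun v i => if (v == VN) && (i == 0) then n else 0.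

Lemma prologue_exec n L Z (m : memory) :
  let b := 2 + 2 * (n * n) in
  let c := Seq (Store base_expr (EGet (ECst 0))) (Store (ECst 0) base_expr) in
  0 < L -> m 0 = n -> (forall x, b <= x -> m x = 0) -> (forall x, m x < 2 ^ L) ->
  exists2 t, exec c m t (mem_of b m (init_state n)) & t <= L * cweight Z c.
Proof.
move=> b c L0 m0 mb mL; pose m1 := upd m b n.
have m10 : m1 0 = n by [].
have m1L x : m1 x < 2 ^ L by rewrite /m1 /upd; case: ifP; rewrite -?m0.
exists (ecost m base_expr + ecost m (EGet (ECst 0)) + (ecost m1 (ECst 0) + ecost m1 base_expr)).
  apply: exec_seq (_ : exec _ m _ m1) _.
    by apply: exec_store_eq => //=; rewrite m0.
  have -> : mem_of b m (init_state n) = upd m1 0 b.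
    apply: functional_extensionality => x; rewrite /mem_of /upd /init_state.
    case: ifP => // x0; case: ltnP => xb; first by rewrite /m1 /upd ltn_eqF.
    rewrite /m1 /upd; have [->|ne] := eqVneq x b; first by rewrite subnn.
    rewrite mb //; case: ifP => // /andP[/eqP ev /eqP ei].
    have xb' : b < x by rewrite ltn_neqAle eq_sym ne.
    have lt18 : (x - b) %% 18 < size vars by rewrite ltn_pmod.
    have := index_uniq VN lt18 (isT : uniq vars); rewrite ev => e0.
    by have := divn_eq (x - b) 18; rewrite ei -e0 /= => /eqP; rewrite subn_eq0 leqNgt xb'.
  by apply: exec_store_eq => //=; rewrite m10.
have lm := leq_add (ecost_le base_expr L0 mL) (ecost_le (EGet (ECst 0)) L0 mL).
have lm1 := leq_add (ecost_le (ECst 0) L0 m1L) (ecost_le base_expr L0 m1L).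
by have := leq_add lm lm1; rewrite -!mulnDr.
Qed.

(** [S] is the best set found and [S'] its padding. The guarantee involves the weight of [S] and the
    size of [S'], the two members of the ratio [B / D]. *)
Lemma algorithm_exec n k L Z (m : memory) :
  let b := 2 + 2 * (n * n) in
  let num p := m (2 + 2 * p) in
  let den p := m (3 + 2 * p) in
  let a p := num p * ((\prod_(q < n * n) den q) %/ den p) in
  let w (i j : 'I_n) := a (i * n + j) in
  0 < k <= n -> m 0 = n -> m 1 = k -> (forall x, b <= x -> m x = 0) ->
  (forall i j, w i j = w j i) ->
  0 < L -> (forall x, m x < 2 ^ L) -> b < 2 ^ L ->
  (forall i, i <= n * n -> \prod_(p < i) den p < 2 ^ L) ->
  4 * n ^ 4 * (\sum_(p < n * n) a p) < 2 ^ L -> 2 * (\sum_(p < n * n) a p) < 2 ^ L ->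
  (4 * n ^ 6).+1 < 2 ^ L -> (4 * n ^ 6).+1 < Z ->
  exists t m' (S S' : {set 'I_n}),
    [/\ exec algorithm m t m', t <= L * cweight Z algorithm, outputs m' S',
        S \subset S' /\ #|S'| = maxn k #|S| &
        forall H : {set 'I_n}, k <= #|H| -> #|S'| * wsum w H <= 2 * wsum w S * #|H|].
Proof.
move=> b num den a w kn m0 m1 mb w_sym L0 mL bL prodL ML WL TL TZ.
have n0 : 0 < n by case/andP: kn; apply: leq_trans.
have eW : wsum w setT = \sum_(p < n * n) a p by rewrite wsum_setT sum_rectangle.
rewrite -eW in ML WL.
have b0 : 0 < b by [].
have nnZ : n * n < Z by apply: leq_ltn_trans TZ; apply: square_le kn.
have aL p : p < n * n -> a p < 2 ^ L.
  move=> pn; apply: leq_ltn_trans WL; rewrite eW (bigD1 (Ordinal pn)) //=.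
  by rewrite mul2n -addnn -addnA leq_addr.
have [t1 ex1 le1] := prologue_exec Z L0 m0 mb mL.
have sL : bounded L (init_state n).
  by move=> v i; rewrite /init_state; case: ifP; rewrite -?m0 ?expn_gt0.
have : ht b m L Z (Seq integer_weights (Seq initialize (Seq ascent pad))) (init_state n)
  (fun s' => s' VN 0 = n /\ exists S S' : {set 'I_n},
    [/\ S \subset S', #|S'| = maxn k #|S|, forall v : 'I_n, s' AY v = (v \in S') &
        forall H : {set 'I_n}, k <= #|H| -> #|S'| * wsum w H <= 2 * wsum w S * #|H|]).
  apply: ht_seq; apply: ht_conseq (integer_weights_spec L0 bL mL nnZ prodL aL _) => //.
  move=> s1 [eN]; rewrite m1 => eK eA.
  apply: ht_seq; apply: ht_conseq (initialize_spec b0 L0 bL mL kn TZ TL ML WL eN eK eA) => s2 [fs2 bs2 eX].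
  apply: ht_seq; apply: ht_conseq (ascent_spec b0 L0 bL mL kn w_sym TZ TL ML WL fs2 bs2 eX) => s3 [fs3 [S bs3] opt].
  apply: ht_conseq (pad_spec b0 L0 bL mL kn TZ TL fs3 bs3) => s4 [eN4 [S' [sub card eY]]].
  split=> //; exists S, S'; split=> // H kH; rewrite card.
  by case: bs3 => _ <- <- _; apply: opt.
case/(_ sL) => t2 [s2 [ex2 le2 s2L [eN [S [S' [sub card eY opt]]]]]].
have nb : n <= b by rewrite /b; nia.
have nZ : n < Z by apply: leq_ltn_trans nnZ; rewrite leq_pmulr.
have [t3 [m3 [ex3 le3 out]]] := write_output_spec n0 nb nZ L0 bL mL s2L eN.
exists (t1 + (t2 + t3)), m3, S, S'; split=> //.
- by apply: exec_seq ex1 _; apply: exec_seq ex2 ex3.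
- by have := leq_add le1 (leq_add le2 le3); rewrite -!mulnDr.
- by move=> v; rewrite out // eY.
Qed.

(** * The encoding *)

Lemma nth_allpairs (S T R : Type) (f : S -> T -> R) s t x0 y0 z0 i j :
  i < size s -> j < size t ->
  nth z0 [seq f x y | x <- s, y <- t] (i * size t + j) = f (nth x0 s i) (nth y0 t j).
Proof.
move=> + jt; elim: s i => //= x s IH [|i] is_; rewrite nth_cat size_map.
  by rewrite mul0n add0n jt (nth_map y0).
by rewrite mulSn -addnA ltnNge leq_addr /= addKn IH.
Qed.

Lemma nth_flatten_pairs (ss : seq (seq nat)) p c :
  all (fun s => size s == 2) ss -> c < 2 ->
  nth 0 (flatten ss) (2 * p + c) = nth 0 (nth [::] ss p) c.
Proof.
move=> + c2; elim: ss p => [|s ss IH] p /=; first by rewrite !nth_nil.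
case/andP=> /eqP s2 /IH{}IH; rewrite nth_cat s2.
case: p => [|p]; first by rewrite muln0 c2.
by rewrite mulnS -addnA ltnNge leq_addr /= addKn IH.
Qed.

Lemma size_flatten_pairs (ss : seq (seq nat)) :
  all (fun s => size s == 2) ss -> size (flatten ss) = 2 * size ss.
Proof. by elim: ss => //= s ss IH /andP[/eqP s2 /IH e]; rewrite size_cat s2 e mulnS. Qed.

Lemma prod_pairs (F : nat -> nat) m :
  \prod_(i < 2 * m) F i = \prod_(p < m) (F (2 * p) * F (2 * p + 1)).
Proof.
elim: m => [|m IH]; first by rewrite !big_ord0.
by rewrite mulnS add2n !big_ord_recr /= IH addn1 mulnA.
Qed.

(** This bounds the sum of the numerators by a product, the quantity that the bit length of the
    input controls. *)
Lemma sum_le_prod (F : nat -> nat) m : \sum_(p < m) F p <= \prod_(p < m) (F p).+1.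
Proof.
elim: m => [|m IH]; first by rewrite !big_ord0.
rewrite !big_ord_recr /= mulnS leq_add // leq_pmull //.
by rewrite prodn_gt0.
Qed.

Section Encoding.
Variables (n : nat) (G : wgraph n) (k : nat).
Let enc := init_mem (encode G k).
Let N := input_size (encode G k).

Definition matrix_entry (i j : 'I_n) : rat := if edge G i j then wt G i j else 0%R.

Let ss := [seq encode_rat (matrix_entry i j) | i <- enum 'I_n, j <- enum 'I_n].

Let encE : encode G k = [:: n, k & flatten ss]. Proof. by []. Qed.

Let ss2 : all (fun s => size s == 2) ss.
Proof. by apply/allP => s /allpairsP[[i j] [_ _ ->]]. Qed.

Let size_ss : size ss = n * n.
Proof. by rewrite size_allpairs size_enum_ord. Qed.

Lemma size_encode : size (encode G k) = 2 + 2 * (n * n).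
Proof. by rewrite encE /= size_flatten_pairs // size_ss. Qed.

Lemma encode_nth (i j : 'I_n) c : c < 2 ->
  enc (2 + 2 * (i * n + j) + c) = nth 0 (encode_rat (matrix_entry i j)) c.
Proof.
move=> c2; rewrite /enc /init_mem encE -addnA /= nth_flatten_pairs //; congr (nth _ _ _).
have {2}-> : n = size (enum 'I_n) by rewrite size_enum_ord.
rewrite (@nth_allpairs _ _ _ _ _ _ i j) ?size_enum_ord //.
by rewrite !nth_ord_enum.
Qed.

Lemma encode_num (i j : 'I_n) : enc (2 + 2 * (i * n + j)) = `|numq (matrix_entry i j)|.
Proof. by rewrite -[_ + _]addn0 encode_nth. Qed.

Lemma encode_den (i j : 'I_n) : enc (3 + 2 * (i * n + j)) = `|denq (matrix_entry i j)|.
Proof. by rewrite (_ : 3 + _ = 2 + 2 * (i * n + j) + 1) ?encode_nth //; lia. Qed.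

Lemma encode_out x : 2 + 2 * (n * n) <= x -> enc x = 0.
Proof. by move=> h; rewrite /enc /init_mem nth_default // size_encode. Qed.

Lemma size_le_input : 2 + 2 * (n * n) <= N.
Proof.
rewrite -size_encode -sum1_size /N /input_size.
by apply: leq_sum.
Qed.

(** Follows from [x + 1 <= 2 ^ bits x]; the bounds below on entries, products and weights all derive
    from this product. *)
Lemma prod_encode_le : \prod_(x <- encode G k) x.+1 <= 2 ^ N.
Proof. by rewrite expn_sum; apply: leq_prod => x _; exact: ltn_exp2_bits. Qed.

Lemma encode_lt x : enc x < 2 ^ N.
Proof.
apply: leq_trans prod_encode_le; have [xs|xs] := ltnP x (size (encode G k)); last first.
  by rewrite /enc /init_mem nth_default // prodn_gt0.
rewrite (big_nth 0) big_mkord (bigD1 (Ordinal xs)) //= leq_pmulr //.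
by rewrite prodn_gt0.
Qed.

Let num p := enc (2 + 2 * p).
Let den p := enc (3 + 2 * p).
Let P := \prod_(p < n * n) den p.
Let a p := num p * (P %/ den p).

Lemma prod_num_den_le : (\prod_(p < n * n) (num p).+1) * (\prod_(p < n * n) (den p).+1) <= 2 ^ N.
Proof.
apply: leq_trans prod_encode_le; rewrite -big_split /=.
rewrite encE !big_cons (big_nth 0) size_flatten_pairs // size_ss big_mkord.
rewrite (prod_pairs (fun i => (nth 0 (flatten ss) i).+1)).
rewrite [X in _ <= _ * (_ * X)](eq_bigr (fun p : 'I_(n * n) => (num p).+1 * (den p).+1)).
  by rewrite mulnA leq_pmull.
by move=> p _; rewrite addn1.
Qed.

Lemma prod_den_le i : i <= n * n -> \prod_(p < i) den p <= 2 ^ N.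
Proof.
move=> im; apply: leq_trans prod_num_den_le.
apply: leq_trans (leq_pmull _ _); last by rewrite prodn_gt0.
apply: leq_trans (_ : \prod_(p < i) (den p).+1 <= _); first exact: leq_prod.
rewrite -!(big_mkord xpredT (fun p => (den p).+1)) (big_cat_nat (n := i) (p := n * n)) //=.
by rewrite leq_pmulr // prodn_gt0.
Qed.

Lemma sum_weights_le : \sum_(p < n * n) a p <= 2 ^ N.
Proof.
apply: leq_trans prod_num_den_le.
apply: leq_trans (_ : (\sum_(p < n * n) num p) * P <= _).
  by rewrite big_distrl; apply: leq_sum => p _; rewrite leq_mul // leq_div.
by rewrite leq_mul // ?(sum_le_prod num) //; apply: leq_prod.
Qed.

Lemma den_gt0 p : p < n * n -> 0 < den p.
Proof.
move=> pn; have n0 : 0 < n by move: pn; case: n.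
have pi : p %/ n < n by rewrite ltn_divLR.
have pj : p %% n < n by rewrite ltn_mod.
have := encode_den (Ordinal pi) (Ordinal pj); rewrite /den /= -divn_eq => ->.
by rewrite absz_gt0 denq_neq0.
Qed.

Lemma P_gt0 : 0 < P.
Proof. by apply: prodn_gt0 => p; apply: den_gt0. Qed.

Let w (i j : 'I_n) := a (i * n + j).

Lemma matrix_entry_sym i j : matrix_entry i j = matrix_entry j i.
Proof. by rewrite /matrix_entry edge_sym wt_sym. Qed.

Lemma int_weight_sym i j : w i j = w j i.
Proof. by rewrite /w /a /num /den !encode_num !encode_den matrix_entry_sym. Qed.

(** Each denominator divides [P], so the integer division of the program is exact; non-edges,
    encoded as 0 over 1, get weight 0. *)
Lemma int_weightE i j : ((w i j)%:R = P%:R * matrix_entry i j :> rat)%R.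
Proof.
have ijn : i * n + j < n * n.
  apply: leq_trans (_ : i.+1 * n <= _); last by rewrite leq_mul2r ltn_ord orbT.
  by rewrite mulSn addnC ltn_add2r.
have dvd : den (i * n + j) %| P by rewrite /P (bigD1 (Ordinal ijn)) //= dvdn_mulr.
have q0 : (0 <= matrix_entry i j)%R.
  by rewrite /matrix_entry; case: ifP => // /wt_pos/ltW.
rewrite /w /a natrM natf_div // mulrCA; congr (_ * _)%R.
rewrite /num /den encode_num encode_den !natr_absz.
by rewrite (ger0_norm (denq_ge0 _)) ger0_norm ?numq_ge0 // divq_num_den.
Qed.

(** [wsum] sees both orders of an edge, [weight] only [i < j]; the diagonal vanishes because there
    are no loops. *)
Lemma wsum_weight (H : {set 'I_n}) : ((wsum w H)%:R = 2%:R * P%:R * weight G H :> rat)%R.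
Proof.
pose q (i j : 'I_n) : rat := if (i < j)%N then matrix_entry i j else 0%R.
have wq : (weight G H = \sum_(i in H) \sum_(j in H) q i j)%R.
  apply: eq_bigr => i _; rewrite big_mkcondr; apply: eq_bigr => j _.
  by rewrite /q /matrix_entry; case: (i < j)%N.
have -> : ((wsum w H)%:R = P%:R * \sum_(i in H) \sum_(j in H) (q i j + q j i))%R.
  rewrite /wsum natr_sum big_distrr; apply: eq_bigr => i _ /=.
  rewrite natr_sum big_distrr; apply: eq_bigr => j _ /=; rewrite int_weightE; congr (_ * _)%R.
  rewrite /q; case: ltngtP => [_|_|/ord_inj->]; rewrite ?addr0 ?add0r //.
    exact: matrix_entry_sym.
  by rewrite /matrix_entry edge_irr.
rewrite (eq_bigr (fun i => \sum_(j in H) q i j + \sum_(j in H) q j i)%R); last first.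
  by move=> i _; rewrite big_split.
rewrite big_split /= [X in (_ + X)%R]exchange_big /= -wq; ring.
Qed.

End Encoding.

(** * Polynomial bound and approximation ratio *)

Lemma wsum_subset (V : finType) (w : V -> V -> nat) (S S' : {set V}) :
  S \subset S' -> wsum w S <= wsum w S'.
Proof.
move=> /subsetP sub; have mono (F : V -> nat) : \sum_(i in S) F i <= \sum_(i in S') F i.
  by rewrite big_mkcond [leqRHS]big_mkcond; apply: leq_sum => i _; case: ifP => // /sub->.
by apply: leq_trans (mono _) _; apply: leq_sum => i _; exact: mono.
Qed.

Local Open Scope ring_scope.

Theorem theorem3 :
  exists (alg : cmd) (p : {poly nat}),
    forall (n : nat) (G : wgraph n) (k : nat), (1 <= k <= n)%N ->
      exists (t : nat) (m : memory) (H : {set 'I_n}),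
        [/\ exec alg (init_mem (encode G k)) t m,
            (t <= p.[input_size (encode G k)])%N,
            outputs m H,
            (k <= #|H|)%N
          & dal G k / 2%:R <= density G H].
Proof.
(* Every loop makes at most [4 * n ^ 6 + 1] rounds, and [n <= N]. *)
pose z : {poly nat} := 4%:P * 'X^6 + 2%:P.
have [q qE] := cweight_poly z algorithm.
(* The factor [8 * N] is the word length [L]: all cells stay below [2 ^ (8 * N)]. *)
exists algorithm, (8%:P * 'X * q) => n G k kn.
set N := input_size (encode G k).
have sN := size_le_input G k; rewrite -/N in sN.
have nN : (n <= N)%N by move: sN; nia.
have N2 : (2 <= N)%N by move: sN; lia.
have zN : z.[N] = (4 * N ^ 6 + 2)%N by rewrite /z hornerD hornerM !hornerC hornerXn natrXE.
have E4 : (4 <= 2 ^ N)%N by rewrite (@leq_exp2l 2 2).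
have NE : (N < 2 ^ N)%N by rewrite ltn_expl.
have EL : (2 ^ (8 * N) = (2 ^ N) ^ 8)%N by rewrite mulnC expnM.
have le8 : (2 ^ N <= 2 ^ (8 * N))%N by rewrite leq_exp2l //; lia.
have n6 : (n ^ 6 <= N ^ 6)%N by rewrite leq_exp2r.
have pow e : (n ^ e <= (2 ^ N) ^ e)%N.
  by case: e => // e; rewrite leq_exp2r //; apply: ltnW; apply: leq_ltn_trans nN NE.
have sw := sum_weights_le G k.
have mul4 e : (4 * (2 ^ N) ^ e <= (2 ^ N) ^ e.+1)%N by rewrite expnS leq_mul.
have lt8 e : (e < 8)%N -> ((2 ^ N) ^ e < 2 ^ (8 * N))%N.
  by move=> e8; rewrite EL ltn_exp2l //; apply: leq_trans E4.
have [] := @algorithm_exec n k (8 * N) (4 * N ^ 6 + 2) (init_mem (encode G k)) => //.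
- exact: encode_out.
- exact: int_weight_sym.
- by lia.
- by move=> x; apply: leq_trans (encode_lt G k x) le8.
- by apply: leq_ltn_trans sN _; apply: leq_trans NE le8.
- move=> i im; apply: leq_ltn_trans (prod_den_le G k im) _.
  by rewrite -[X in (X < _)%N]expn1 lt8.
- apply: leq_ltn_trans (lt8 6 isT); apply: leq_trans (mul4 5).
  rewrite -mulnA; apply: leq_mul => //; rewrite (expnSr (2 ^ N) 4).
  exact: leq_mul (pow 4) sw.
- apply: leq_ltn_trans (lt8 2 isT); rewrite (expnS _ 1) expn1 leq_mul //.
  by apply: leq_trans E4.
(* The estimate [4 * n ^ 6 + 1 <= (2 ^ N) ^ 7 + 1] is the one that calls for the exponent 8. *)
- apply: leq_ltn_trans (_ : _ <= (2 ^ N) ^ 7 + 1)%N _.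
    by rewrite addn1 ltnS; apply: leq_trans (mul4 6); apply: leq_mul.
  have e7 : (0 < (2 ^ N) ^ 7)%N by rewrite !expn_gt0.
  by rewrite EL; apply: leq_trans (mul4 7); move: ((2 ^ N) ^ 7)%N e7 => x; lia.
- by rewrite addn2 !ltnS leq_mul.
move=> t [m [S [S' [ex le out [sub card] opt]]]].
exists t, m, S'; split=> //.
- apply: leq_trans le _; by rewrite !hornerM hornerC hornerX qE zN.
- by rewrite card leq_maxl.
have k0 : (0 < k)%N by case/andP: kn.
have S'0 : 0 < #|S'|%:R :> rat by rewrite ltr0n card; apply: leq_trans k0 (leq_maxl _ _).
rewrite ler_pdivrMr ?ltr0n //; apply: bigmax_le.
  (* The default value 0 of the maximum is at most twice a nonnegative density. *)
  rewrite mulr_ge0 ?ler0n // /density divr_ge0 ?ler0n //.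
  by apply: sumr_ge0 => i _; apply: sumr_ge0 => j /andP[_ /andP[_ /wt_pos/ltW]].
move=> H kH; have H0 : 0 < #|H|%:R :> rat by rewrite ltr0n; apply: leq_trans kH.
(* Padding loses no weight, so the weight of [S] may be replaced by that of [S']. *)
have := leq_trans (opt H kH) (leq_mul (leq_mul (leqnn 2) (wsum_subset _ sub)) (leqnn _)).
rewrite -(ler_nat rat) !natrM !wsum_weight; set P := (\prod_(p < _) _)%N => h.
(* Double counting and cleared denominators give both sides this common factor, which cancels. *)
have P0 : 0 < 2%:R * P%:R :> rat by rewrite mulr_gt0 ?ltr0n // P_gt0.
rewrite /density ler_pdivrMr // (mulrAC _ _^-1) (mulrAC _ _^-1) ler_pdivlMr //.
rewrite -(ler_pM2l P0); move: h; congr (_ <= _); ring.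
Qed.
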